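(* Consider the sparse linear Gaussian model: $S\in\{1,\dots,N\}$, $\mathcal{X}_S=\{\mathbf{x}\in\mathbb{R}^N:\|\mathbf{x}\|_0\le S\}$, $\mathbf{H}\in\mathbb{R}^{M\times N}$ with $\operatorname{spark}(\mathbf{H})>S$, $\sigma>0$, observation $\mathbf{y}=\mathbf{H}\mathbf{x}+\mathbf{n}$, $\mathbf{n}\sim\mathcal{N}(\mathbf{0},\sigma^2\mathbf{I})$, a parameter function $g:\mathcal{X}_S\to\mathbb{R}$, and $\mathbf{x}_0\in\mathcal{X}_S$. Let $D=\operatorname{rank}(\mathbf{H})$, $\mathbf{H}=\mathbf{U}\mathbf{\Sigma}\mathbf{V}^T$ a thin SVD and $\widetilde{\mathbf{H}}=\mathbf{V}\mathbf{\Sigma}^{-1}$. Let $c:\mathcal{X}_S\to\mathbb{R}$ be a bias function valid at $\mathbf{x}_0$, $\gamma=c+g$, and let $\mathcal{C}(c)\subseteq\ell^2(\mathbb{Z}_+^D)$ be the set of sequences $a$ such that for all $\mathbf{x}\in\mathcal{X}_S$ $$c(\mathbf{x})=\exp\Big(\tfrac{1}{2\sigma^2}\|\mathbf{H}\mathbf{x}_0\|_2^2-\tfrac{1}{\sigma^2}\mathbf{x}^T\mathbf{H}^T\mathbf{H}\mathbf{x}_0\Big)\sum_{\mathbf{p}\in\mathbb{Z}_+^D}\frac{a[\mathbf{p}]}{\sqrt{\mathbf{p}!}}\Big(\tfrac{1}{\sigma}\widetilde{\mathbf{H}}^{\dagger}\mathbf{x}\Big)^{\mathbf{p}}-g(\mathbf{x}).$$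 Define $\rho_{\mathbf{x}_0}(\mathbf{y},\mathbf{x})=\exp\big(-\tfrac{1}{2\sigma^2}[2\mathbf{y}^T\mathbf{H}(\mathbf{x}_0-\mathbf{x})+\|\mathbf{H}\mathbf{x}\|_2^2-\|\mathbf{H}\mathbf{x}_0\|_2^2]\big)$ for $\mathbf{x}\in\mathbb{R}^N$ and $$\chi_{\mathbf{p}}(\mathbf{y})=\frac{\partial^{\mathbf{p}}}{\partial\mathbf{z}^{\mathbf{p}}}\Big[\rho_{\mathbf{x}_0}(\mathbf{y},\sigma\widetilde{\mathbf{H}}\mathbf{z})\exp\big(\tfrac{1}{\sigma}\mathbf{x}_0^T\mathbf{H}^T\mathbf{H}\widetilde{\mathbf{H}}\mathbf{z}\big)\Big]\Big|_{\mathbf{z}=\mathbf{0}},\quad\mathbf{p}\in\mathbb{Z}_+^D.$$ Then: (1) The minimum achievable variance at $\mathbf{x}_0$ equals $M(c,\mathbf{x}_0)=\min_{a\in\mathcal{C}(c)}\sum_{\mathbf{p}\in\mathbb{Z}_+^D}a^2[\mathbf{p}]-\gamma^2(\mathbf{x}_0)$ (the minimum being attained). (2) For every $a\in\mathcal{C}(c)$, the estimator $\hat g(\mathbf{y})=\exp\big(-\tfrac{1}{2\sigma^2}\|\mathbf{H}\mathbf{x}_0\|_2^2\big)\sum_{\mathbf{p}\in\mathbb{Z}_+^D}\frac{a[\mathbf{p}]}{\sqrt{\mathbf{p}!}}\chi_{\mathbf{p}}(\mathbf{y})$ has finite variance at $\mathbf{x}_0$ and bias function equal to $c$ on $\mathcal{X}_S$.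 (3) The LMV estimator at $\mathbf{x}_0$ for $c$ is the estimator in (2) with $a=a_0=\arg\min_{a\in\mathcal{C}(c)}\|a\|_{\ell^2(\mathbb{Z}_+^D)}$.
   Context: $\|\cdot\|_0$ = number of nonzero entries; $\operatorname{spark}$ = minimum number of linearly dependent columns; $\dagger$ = Moore–Penrose pseudoinverse; multi-index notation $\mathbf{p}!=\prod p_l!$, $\mathbf{z}^{\mathbf{p}}=\prod z_l^{p_l}$, $\partial^{\mathbf{p}}/\partial\mathbf{z}^{\mathbf{p}}=\prod_l\partial^{p_l}/\partial z_l^{p_l}$. An estimator $\hat g:\mathbb{R}^M\to\mathbb{R}$ has bias $b(\hat g;\mathbf{x})=\mathsf{E}_{\mathbf{x}}\{\hat g(\mathbf{y})\}-g(\mathbf{x})$ and variance $v(\hat g;\mathbf{x})=\mathsf{E}_{\mathbf{x}}\{(\hat g(\mathbf{y})-\mathsf{E}_{\mathbf{x}}\hat g(\mathbf{y}))^2\}$. $c$ is valid at $\mathbf{x}_0$ if the set $\mathcal{A}(c,\mathbf{x}_0)$ of estimators with $v(\hat g;\mathbf{x}_0)<\infty$ and $b(\hat g;\mathbf{x})=c(\mathbf{x})$ for all $\mathbf{x}\in\mathcal{X}_S$ is nonempty; the minimum achievable variance is $M(c,\mathbf{x}_0)=\inf_{\hat g\in\mathcal{A}(c,\mathbf{x}_0)}v(\hat g;\mathbf{x}_0)$, and an LMV (locally minimum variance) estimator is an element of $\mathcal{A}(c,\mathbf{x}_0)$ attaining this infimum. *)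

(* Defs.v *)
From HB Require Import structures.
From mathcomp Require Import all_boot all_order all_algebra.
From mathcomp Require Import all_classical all_reals all_analysis.
Set Implicit Arguments. Unset Strict Implicit. Unset Printing Implicit Defensive.
Import Order.TTheory GRing.Theory Num.Theory.
Import numFieldNormedType.Exports.
Local Open Scope classical_set_scope.
Local Open Scope ring_scope.

Section LinAlg.
Variable R : realType.

Definition l0norm n (x : 'cV[R]_n) : nat := #|[set i | x i 0 != 0]|.

Definition sparse_set {N : nat} (S : nat) : set 'cV[R]_N :=
  [set x | (l0norm x <= S)%N].

Definition lin_dep_cols M N (H : 'M[R]_(M, N)) (T : {set 'I_N}) : Prop :=
  exists v : 'cV[R]_N, v != 0 /\ (forall i, i \notin T -> v i 0 = 0) /\
                       H *m v = 0.

(* spark H = minimum number of linearly dependent columns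
   (= N+1, standing for +infinity, if the columns are independent) *)
Definition spark M N (H : 'M[R]_(M, N)) : nat :=
  \big[minn/N.+1]_(T : {set 'I_N} | `[< lin_dep_cols H T >]) #|T|.

Definition is_pinv m n (A : 'M[R]_(m, n)) (B : 'M[R]_(n, m)) : Prop :=
  [/\ A *m B *m A = A, B *m A *m B = B,
      (A *m B)^T = A *m B & (B *m A)^T = B *m A].

Definition thin_svd M N D (H : 'M[R]_(M, N)) (U : 'M[R]_(M, D))
  (s : 'rV[R]_D) (V : 'M[R]_(N, D)) : Prop :=
  [/\ U^T *m U = 1%:M, V^T *m V = 1%:M, (forall i, 0 < s 0 i) &
      H = U *m diag_mx s *m V^T].

Definition sqnorm n (x : 'cV[R]_n) : R := \sum_i (x i 0) ^+ 2.

Definition tcol n (t : n.-tuple R) : 'cV[R]_n := \col_i tnth t i.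

End LinAlg.

Notation mindex D := {ffun 'I_D -> nat}.

Section MultiIndex.
Variable R : realType.


Definition mfact D (p : mindex D) : R := \prod_l ((p l)`!)%:R.
Definition mpow D (z : 'cV[R]_D) (p : mindex D) : R := \prod_l (z l 0) ^+ (p l).

Definition in_l2 D (a : mindex D -> R) : Prop :=
  (\esum_(p in [set: mindex D]) ((a p) ^+ 2)%:E < +oo)%E.

Definition l2sq D (a : mindex D -> R) : R :=
  fine (\esum_(p in [set: mindex D]) ((a p) ^+ 2)%:E).

(* unordered sum of a (absolutely summable) real family over a countable
   index set: positive part minus negative part *)
Definition usum (T : choiceType) (f : T -> R) : R :=
  fine (\esum_(i in [set: T]) (Num.max (f i) 0)%:E) -
  fine (\esum_(i in [set: T]) (Num.max (- f i) 0)%:E).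

Definition partial D (l : 'I_D) (f : 'cV[R]_D -> R) : 'cV[R]_D -> R :=
  'D_(delta_mx l 0 : 'cV[R]_D) f.

Definition mderiv D (p : mindex D) (f : 'cV[R]_D -> R) : 'cV[R]_D -> R :=
  foldr (fun l h => iter (p l) (partial l) h) f (enum 'I_D).

End MultiIndex.

Section Model.
Local Open Scope ereal_scope.
Context {R : realType} {d : measure_display} {Omega : measurableType d}.
Variable P : probability Omega R.
Variables (M N : nat) (H : 'M[R]_(M, N)) (noise : Omega -> M.-tuple R).

(* noise has i.i.d. N(0, sigma^2) components: its law on the product
   sigma-algebra of R^M is the product of the normal laws *)
Definition gauss_noise (sigma : R) : Prop :=
  measurable_fun [set: Omega] noise /\
  forall B : 'I_M -> set R, (forall i, measurable (B i)) ->
    P [set w | forall i, B i (tnth (noise w) i)] =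
    ((\prod_i fine (normal_prob 0 sigma (B i)))%R)%:E.

Definition obs (x : 'cV[R]_N) (w : Omega) : 'cV[R]_M :=
  (H *m x + tcol (noise w))%R.

Definition is_estimator (gh : 'cV[R]_M -> R) : Prop :=
  measurable_fun [set: M.-tuple R] (gh \o @tcol R M).

Definition mean (gh : 'cV[R]_M -> R) (x : 'cV[R]_N) : R :=
  fine (\int[P]_w (gh (obs x w))%:E).

Definition est_variance (gh : 'cV[R]_M -> R) (x : 'cV[R]_N) : \bar R :=
  \int[P]_w (((gh (obs x w) - mean gh x) ^+ 2)%R)%:E.

Definition bias (gh : 'cV[R]_M -> R) (g : 'cV[R]_N -> R) (x : 'cV[R]_N) : R :=
  (mean gh x - g x)%R.

Definition mean_exists (gh : 'cV[R]_M -> R) (x : 'cV[R]_N) : Prop :=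
  P.-integrable [set: Omega] (fun w => (gh (obs x w))%:E).

Definition admissible (S : nat) (g c : 'cV[R]_N -> R) (x0 : 'cV[R]_N)
  : set ('cV[R]_M -> R) :=
  [set gh | [/\ is_estimator gh, mean_exists gh x0, est_variance gh x0 < +oo &
     forall x, sparse_set S x -> mean_exists gh x /\ bias gh g x = c x]].

Definition valid_bias S g c x0 : Prop := admissible S g c x0 !=set0.

Definition min_var S g c x0 : R :=
  inf [set fine (est_variance gh x0) | gh in admissible S g c x0].

Definition is_LMV S g c x0 (gh : 'cV[R]_M -> R) : Prop :=
  admissible S g c x0 gh /\ fine (est_variance gh x0) = min_var S g c x0.

(* gh is an L^2(P_{x0}) limit of the partial sums (over the boxes
   {p : p_l <= K}) of the series sum_p t p *)
Definition L2_series_limit D (t : mindex D -> 'cV[R]_M -> R) (x0 : 'cV[R]_N)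
  (gh : 'cV[R]_M -> R) : Prop :=
  is_estimator gh /\
  (fun K : nat => \int[P]_w
     (((\sum_(q : {ffun 'I_D -> 'I_K.+1}) t [ffun l => val (q l)] (obs x0 w)
        - gh (obs x0 w)) ^+ 2)%R)%:E) @ \oo --> 0.

End Model.

(* Main.v *)
Require Import Defs.
From HB Require Import structures.
From mathcomp Require Import all_boot all_order all_algebra.
From mathcomp Require Import all_classical all_reals all_analysis.
From mathcomp Require Import measurable_realfun ring lra.
Set Implicit Arguments. Unset Strict Implicit. Unset Printing Implicit Defensive.
Import Order.TTheory GRing.Theory Num.Theory.
Import numFieldNormedType.Exports.
Local Open Scope classical_set_scope.
Local Open Scope ring_scope.

(** Write m0 = H x0 and let mu be the law of the observation y at x0.  The functions
    e_p = exp (- |m0|^2 / (2 sigma^2)) chi_p / sqrt p! are an exponential times a product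
    of Hermite polynomials in U^T (y + m0) / sigma.  Multiplying mu by the square of the
    exponential moves its mean from m0 to - m0 (Cameron-Martin), where these arguments
    are independent standard normal: hence the e_p are orthonormal in L^2(mu), and the
    likelihood ratio L_x of the model at x satisfies
      <L_x, e_p> = exp (|m0|^2 / (2 sigma^2) - x^T H^T H x0 / sigma^2) z^p / sqrt p!
    with z = U^T H x / sigma.  The squares of these coefficients add up to |L_x|^2, so
    L_x is in the closed span of the e_p.

    An estimator has bias c if and only if <gh, L_x> = c x + g x for all sparse x, a
    moment problem in L^2(mu) which Parseval's identity turns into membership of the
    coefficients of gh in C(c), and its variance is |gh|^2 - gamma^2.  Bessel's inequality
    and the Riesz-Fischer theorem then identify the minimal norms of the two problems;
    a minimum exists by completeness of L^2(mu). *)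

(** * Measures with a density *)

Section mdensity.
Local Open Scope ereal_scope.
Context d (T : measurableType d) (R : realType) (mu : {measure set T -> \bar R}).
Variable w : T -> R.

(* The two proofs are arguments so that the measure structure can be inferred. *)
Definition mdensity of measurable_fun setT w & (forall x, (0 <= w x)%R) :=
  fun A : set T => \int[mu]_(x in A) (w x)%:E.

Hypotheses (mw : measurable_fun setT w) (w0 : forall x, (0 <= w x)%R).
Local Notation nu := (mdensity mw w0).

Let mdensity0 : nu set0 = 0.
Proof. exact: integral_set0. Qed.

Let mdensity_ge0 A : 0 <= nu A.
Proof. by apply: integral_ge0 => x _; rewrite lee_fin. Qed.

Let mdensity_sigma_additive : semi_sigma_additive nu.
Proof.
move=> F mF tF mUF; rewrite /mdensity ge0_integral_bigcup//.
- by apply: is_cvg_ereal_nneg_natsum_cond => n _ _; exact: mdensity_ge0.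
- by apply: measurable_funTS; exact/measurable_EFinP.
- by move=> x _; rewrite lee_fin.
Qed.

HB.instance Definition _ := isMeasure.Build _ _ _ nu
  mdensity0 mdensity_ge0 mdensity_sigma_additive.

Lemma mdensityE A : nu A = \int[mu]_x (w x * \1_A x)%:E.
Proof.
rewrite /mdensity integral_mkcond; apply: eq_integral => x _.
by rewrite patchE indicE; case: ifP; rewrite ?mulr1 ?mulr0.
Qed.

Import HBNNSimple.

Let integral_mdensity_nnsfun (g : {nnsfun T >-> R}) :
  \int[nu]_x (g x)%:E = \int[mu]_x ((w x)%:E * (g x)%:E).
Proof.
rewrite integralT_nnsfun sintegralE.
under [RHS]eq_integral => x _.
  rewrite -EFinM fimfunE fsbig_finite//= mulr_sumr -sumEFin -fsbig_finite//=.
  over.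
rewrite ge0_integral_fsum//.
- apply: eq_fsbigr => r rg; rewrite [X in _ * X]mdensityE.
  have r0 : (0 <= r)%R by move: rg; rewrite inE => -[x _ <-].
  rewrite -ge0_integralZl//; last 2 first.
  + by apply/measurable_EFinP; exact: measurable_funM.
  + by move=> x _; rewrite lee_fin mulr_ge0.
  by apply: eq_integral => x _; rewrite -EFinM mulrCA.
- move=> r; apply/measurable_EFinP; apply: measurable_funM => //.
  exact: measurable_funM.
- move=> r x _; rewrite lee_fin mulr_ge0//.
  by have := nnfun_muleindic_ge0 g r x; rewrite lee_fin.
Qed.

Lemma ge0_integral_mdensity (f : T -> \bar R) :
  measurable_fun setT f -> (forall x, 0 <= f x) ->
  \int[nu]_x f x = \int[mu]_x ((w x)%:E * f x).
Proof.
move=> mf f0; pose f_ := nnsfun_approx measurableT mf.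
have f_cvg x : (f_ n x)%:E @[n --> \oo] --> f x by exact: cvg_nnsfun_approx.
have f_nd x : nondecreasing_seq (fun n => (f_ n x)%:E).
  by move=> m n mn; rewrite lee_fin; exact/lefP/nd_nnsfun_approx.
transitivity (limn (fun n => \int[nu]_x (f_ n x)%:E)).
  rewrite -monotone_convergence//.
  - by apply: eq_integral => x _; exact/esym/cvg_lim.
  - by move=> n; exact/measurable_EFinP/measurable_funP.
  - by move=> n x _; rewrite lee_fin.
transitivity (limn (fun n => \int[mu]_x ((w x)%:E * (f_ n x)%:E))).
  by congr (limn _); apply/funext => n; exact: integral_mdensity_nnsfun.
rewrite -monotone_convergence//.
- by apply: eq_integral => x _; apply/cvg_lim => //; exact: cvgeZl.
- by move=> n; apply/measurable_EFinP; exact: measurable_funM.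
- by move=> n x _; rewrite lee_fin mulr_ge0.
- by move=> x _ m n mn; rewrite lee_wpmul2l ?lee_fin//; exact: f_nd.
Qed.

End mdensity.

Section mdensity_lemmas.
Context d (T : measurableType d) (R : realType).
Variables (w v : T -> R).
Hypotheses (mw : measurable_fun setT w) (w0 : forall x, 0 <= w x).
Hypotheses (mv : measurable_fun setT v) (v0 : forall x, 0 <= v x).

Lemma eq_mdensity (mu1 mu2 : {measure set T -> \bar R}) :
  (forall A, measurable A -> mu1 A = mu2 A) ->
  forall A, measurable A -> mdensity mu1 mw w0 A = mdensity mu2 mw w0 A.
Proof.
by move=> mu12 A mA; apply: eq_measure_integral => B mB _; exact: mu12.
Qed.

Lemma mdensityM (m : {measure set T -> \bar R}) (u : T -> R) (mu : measurable_fun setT u)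
    (u0 : forall x, 0 <= u x) : (forall x, u x = w x * v x) ->
  forall A, measurable A ->
  mdensity m mu u0 A = mdensity (mdensity m mw w0) mv v0 A.
Proof.
move=> uE A mA; rewrite !mdensityE ge0_integral_mdensity.
- by apply: eq_integral => x _; rewrite uE -EFinM mulrA.
- by apply/measurable_EFinP; exact: measurable_funM.
- by move=> x; rewrite lee_fin mulr_ge0.
Qed.

End mdensity_lemmas.

Section has_integral.
Context d (T : measurableType d) (R : realType).
Implicit Types (mu : {measure set T -> \bar R}) (f g : T -> R).

Definition has_integral mu f (v : R) : Prop :=
  mu.-integrable setT (EFin \o f) /\ \int[mu]_x f x = v.

Lemma has_integral_integral mu f v :
  has_integral mu f v -> (\int[mu]_x (f x)%:E)%E = v%:E.
Proof. by move=> [fi <-]; rewrite fineK//; exact: integrable_fin_num. Qed.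

Lemma has_integral_cst (P : probability T R) k : has_integral P (fun=> k) k.
Proof.
split; first exact: finite_measure_integrable_cst.
by rewrite Rintegral_cst// [X in fine X]probability_setT mulr1.
Qed.

Lemma has_integralZl mu k f v :
  has_integral mu f v -> has_integral mu (fun x => k * f x) (k * v).
Proof.
by move=> [fi <-]; split; [exact: (integrableZl measurableT k fi)|rewrite RintegralZl].
Qed.

Lemma has_integralD mu f g u v : has_integral mu f u -> has_integral mu g v ->
  has_integral mu (fun x => f x + g x) (u + v).
Proof.
move=> [fi <-] [gi <-]; split; first exact: (integrableD measurableT fi gi).
by rewrite RintegralD.
Qed.

Lemma le_normr_integrable mu f g : measurable_fun setT f ->
  (forall x, `|f x| <= g x) -> mu.-integrable setT (EFin \o g) ->
  mu.-integrable setT (EFin \o f).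
Proof.
move=> mf fg; apply: le_integrable => //; first exact/measurable_EFinP.
by move=> x _ /=; rewrite lee_fin (le_trans (fg x))// ler_norm.
Qed.

End has_integral.

Section change_of_variables.
Context d1 d2 (X : measurableType d1) (Y : measurableType d2) (R : realType).
Variables (mu : {measure set X -> \bar R}) (nu : {measure set Y -> \bar R}).
Variables (phi : X -> Y) (w : X -> R).
Hypotheses (mphi : measurable_fun setT phi) (mw : measurable_fun setT w).
Hypothesis w0 : forall x, 0 <= w x.
Hypothesis ge0_integral_nu : forall f : Y -> \bar R, measurable_fun setT f ->
  (forall y, (0 <= f y)%E) ->
  (\int[nu]_y f y = \int[mu]_x ((w x)%:E * f (phi x)))%E.

Lemma has_integral_change f v : measurable_fun setT f ->
  has_integral nu f v <-> has_integral mu (fun x => w x * f (phi x)) v.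
Proof.
move=> mf; have mEf : measurable_fun setT (EFin \o f) by exact/measurable_EFinP.
have integrable_change : nu.-integrable setT (EFin \o f) <->
    mu.-integrable setT (EFin \o (fun x => w x * f (phi x))).
  have mwf : measurable_fun setT (fun x => w x * f (phi x)).
    by apply: measurable_funM => //; exact: measurableT_comp.
  have normE : (\int[nu]_y `|(f y)%:E| = \int[mu]_x `|(w x * f (phi x))%:E|)%E.
    rewrite ge0_integral_nu//; last exact: measurableT_comp.
    by apply: eq_integral => x _; rewrite /= normrM ger0_norm.
  split=> /integrableP[_ fi]; apply/integrableP; split=> //.
  - exact/measurable_EFinP.
  - by rewrite -normE.
  - by rewrite normE.
suff RintegralE : \int[mu]_x (w x * f (phi x)) = \int[nu]_y f y.
  by rewrite /has_integral RintegralE; split=> -[/integrable_change].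
rewrite /Rintegral [in LHS]integralE [in RHS]integralE; congr fine.
rewrite !ge0_integral_nu//; try by
  [exact: measurable_funepos|exact: measurable_funeneg].
by congr (_ - _)%E; apply: eq_integral => x _;
  rewrite ?funeposE ?funenegE -?EFinN -?mulrN EFinM maxe_pMr ?mule0// lee_fin.
Qed.

End change_of_variables.

Section product_law.
Local Open Scope ereal_scope.
Context d (T : measurableType d) (R : realType) (n : nat).
Implicit Types (B : 'I_n -> set T) (nu : 'I_n -> probability T R).

Definition box B : set (n.-tuple T) := [set t | forall i, B i (tnth t i)].

Definition product_law nu (Q : set (n.-tuple T) -> \bar R) : Prop :=
  forall B, (forall i, measurable (B i)) ->
    Q (box B) = (\prod_i fine (nu i (B i)))%R%:E.

Lemma boxE B : box B = \big[setI/setT]_(i < n) ((@tnth _ _ ^~ i) @^-1` B i).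
Proof.
rewrite -bigcap_seq; apply/seteqP; split=> t /= Bt i; first by move=> _; exact: Bt.
by apply: Bt; rewrite /= mem_index_enum.
Qed.

Lemma measurable_box B : (forall i, measurable (B i)) -> measurable (box B).
Proof.
move=> mB; rewrite boxE; apply: bigsetI_measurable => i _.
by rewrite -[X in measurable X]setTI; exact: measurable_tnth.
Qed.

Lemma box_setT : box (fun=> setT) = setT.
Proof. by apply/seteqP; split. Qed.

Lemma indic_box B t : \1_(box B) t = (\prod_i \1_(B i) (tnth t i))%R :> R.
Proof.
have [Bt|/existsNP[i nBi]] := pselect (box B t).
  by rewrite indicE mem_set// big1// => i _; rewrite indicE mem_set//; exact: Bt.
rewrite indicE memNset => [|/(_ i)//].
by rewrite (bigD1 i)//= indicE memNset// mul0r.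
Qed.

Lemma measurable_generated_box : measurable =
  <<s [set box B | B in [set B : 'I_n -> set T | forall i, measurable (B i)] ] >>.
Proof.
apply/seteqP; split; apply: smallest_sub.
- exact: smallest_sigma_algebra.
- move=> A; rewrite -bigcup_seq/= => -[i _ [C mC <-]]; apply: sub_sigma_algebra.
  exists (fun j => if j == i then C else setT) => [j /=|]; first by case: ifP.
  apply/seteqP; split=> t /=; first by move=> /(_ i); rewrite eqxx.
  by move=> [_ Ct] j; case: eqP => // ->.
- exact: sigma_algebra_measurable.
- by move=> _ [B mB <-]; exact: measurable_box.
Qed.

Lemma product_law_unique nu (Q1 Q2 : {measure set (n.-tuple T) -> \bar R}) :
  product_law nu Q1 -> product_law nu Q2 ->
  forall A, measurable A -> Q1 A = Q2 A.
Proof.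
move=> Q1nu Q2nu A mA; apply: (measure_unique _ (fun=> setT)
  measurable_generated_box) => //.
- move=> _ _ [B mB <-] [C mC <-]; exists (fun i => B i `&` C i).
    by move=> i; exact: measurableI.
  apply/seteqP; split=> t; last by move=> [Bt Ct] i; split.
  by move=> BCt; split=> i; have [] := BCt i.
- by move=> _; exists (fun=> setT) => //; exact: box_setT.
- by apply/seteqP; split=> // x _; exists 0%N.
- by move=> _ [B mB <-]; rewrite Q1nu// Q2nu.
- by move=> _; rewrite -box_setT Q1nu// ltry.
Qed.

End product_law.

Section product_law_mdensity.
Local Open Scope ereal_scope.
Context d (T : measurableType d) (R : realType) (n : nat).
Implicit Types (Q : {measure set (n.-tuple T) -> \bar R}).

Lemma measurable_prod_tnth (s : seq 'I_n) (w : 'I_n -> T -> R) :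
  (forall i, measurable_fun setT (w i)) ->
  measurable_fun setT (fun t => (\prod_(i <- s) w i (tnth t i))%R).
Proof.
move=> mw; apply: measurable_prod => i _.
by apply: measurableT_comp => //; exact: measurable_tnth.
Qed.

Lemma prod_tnth_ge0 (s : seq 'I_n) (w : 'I_n -> T -> R) :
  (forall i x, (0 <= w i x)%R) ->
  forall t, (0 <= \prod_(i <- s) w i (tnth t i))%R.
Proof. by move=> w0 t; apply: prodr_ge0. Qed.

Lemma product_law_integral_tnth (nu : 'I_n -> probability T R) Q B k
    (f : T -> \bar R) :
  product_law nu Q -> (forall i, measurable (B i)) -> B k = setT ->
  measurable_fun setT f -> (forall x, 0 <= f x) ->
  \int[Q]_t ((\1_(box B) t)%:E * f (tnth t k)) =
  (\prod_(i | i != k) fine (nu i (B i)))%R%:E * \int[nu k]_x f x.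
Proof.
move=> Qnu mB BkT mf f0; have mboxB := measurable_box mB.
have c0 : (0 <= \prod_(i | i != k) fine (nu i (B i)))%R.
  by apply: prodr_ge0 => i _; exact: fine_ge0.
have mI : measurable_fun setT (\1_(box B) : n.-tuple T -> R) by [].
have I0 t : (0 <= \1_(box B) t :> R)%R by [].
have marginal A : measurable A ->
    pushforward (mdensity Q mI I0) (@tnth _ _ ^~ k) A = mscale (NngNum c0) (nu k) A.
  move=> mA; rewrite /pushforward /mscale/=.
  pose BA i := if i == k then A else B i.
  have mBA i : measurable (BA i) by rewrite /BA; case: ifP.
  have boxBA : box B `&` (fun t => tnth t k) @^-1` A = box BA.
    apply/seteqP; split=> t.
      by move=> [Bt /= At] i; rewrite /BA; case: eqP => [->|].
    move=> BAt; split=> [i|/=]; last by have := BAt k; rewrite /BA eqxx.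
    by have := BAt i; rewrite /BA; case: eqP => // ->; rewrite BkT.
  have mkA : measurable ((fun t : n.-tuple T => tnth t k) @^-1` A).
    by rewrite -[X in measurable X]setTI; exact: measurable_tnth.
  rewrite /mdensity integral_indic//= boxBA Qnu// (bigD1 k)//=.
  rewrite {1}/BA eqxx mulrC EFinM fineK ?fin_num_measure//.
  by congr (_%:E * _); apply: eq_bigr => i /negbTE; rewrite /BA => ->.
transitivity (\int[mscale (NngNum c0) (nu k)]_x f x); last by rewrite ge0_integral_mscale.
transitivity (\int[pushforward (mdensity Q mI I0) (@tnth _ _ ^~ k)]_x f x); last first.
  apply: eq_measure_integral => [|mtnth A mA _]; [exact: measurable_tnth|exact: marginal].
rewrite (ge0_integral_pushforward (measurable_tnth k))// ge0_integral_mdensity//.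
- exact: measurableT_comp (measurable_tnth k).
- by move=> t; exact: f0.
Qed.

Lemma product_law_mdensity_tnth (nu nu' : 'I_n -> probability T R) Q k
    (w : T -> R) (mw : measurable_fun setT w) (w0 : forall x, (0 <= w x)%R)
    (mwk : measurable_fun setT (fun t : n.-tuple T => w (tnth t k)))
    (wk0 : forall t : n.-tuple T, (0 <= w (tnth t k))%R) :
  (forall i, i != k -> nu' i = nu i) ->
  (forall A, measurable A -> nu' k A = mdensity (nu k) mw w0 A) ->
  product_law nu Q -> product_law nu' (mdensity Q mwk wk0).
Proof.
move=> nu'E nu'k Qnu B mB; pose C i := if i == k then setT else B i.
have mC i : measurable (C i) by rewrite /C; case: ifP.
rewrite mdensityE.
transitivity (\int[Q]_t ((\1_(box C) t)%:E * (w (tnth t k) * \1_(B k) (tnth t k))%:E)).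
  apply: eq_integral => t _; rewrite -EFinM; congr EFin.
  rewrite !indic_box (bigD1 k)//= [in RHS](bigD1 k)//=.
  rewrite {1}/C eqxx indicT mul1r mulrA [RHS]mulrC; congr (_ * _)%R.
  by apply: eq_bigr => i /negbTE; rewrite /C => ->.
rewrite (product_law_integral_tnth (f := fun x => (w x * \1_(B k) x)%:E) Qnu)//.
- rewrite -(mdensityE (nu k) mw w0) -nu'k// [in RHS](bigD1 k)//= EFinM fineK ?fin_num_measure//.
  rewrite muleC; congr (_ * _%:E); apply: eq_bigr => i ik.
  by rewrite nu'E// /C (negbTE ik).
- by rewrite /C eqxx.
- by apply/measurable_EFinP; exact: measurable_funM.
- by move=> x; rewrite lee_fin mulr_ge0.
Qed.

Lemma product_law_mdensity (nu nu' : 'I_n -> probability T R) Q (w : 'I_n -> T -> R)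
    (mw : forall i, measurable_fun setT (w i)) (w0 : forall i x, (0 <= w i x)%R) :
  (forall i A, measurable A -> nu' i A = mdensity (nu i) (mw i) (w0 i) A) ->
  product_law nu Q ->
  product_law nu' (mdensity Q (measurable_prod_tnth (index_enum 'I_n) mw)
    (prod_tnth_ge0 (index_enum 'I_n) w0)).
Proof.
move=> nu'E Qnu; pose nus (s : seq 'I_n) i := if i \in s then nu' i else nu i.
have tilted s : uniq s -> product_law (nus s)
    (mdensity Q (measurable_prod_tnth s mw) (prod_tnth_ge0 s w0)).
  elim: s => [_ B mB|k s IH /= /andP[ks us] B mB].
    rewrite mdensityE -[RHS]Qnu// -[in RHS](setIT (box B)) -integral_indic//; last first.
      exact: measurable_box.
    by apply: eq_integral => t _; rewrite big_nil mul1r.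
  have mwk : measurable_fun setT (fun t : n.-tuple T => w k (tnth t k)).
    exact: measurableT_comp (mw k) (measurable_tnth k).
  have wk0 (t : n.-tuple T) : (0 <= w k (tnth t k))%R by exact: w0.
  rewrite -(@product_law_mdensity_tnth (nus s) _ _ k (w k) (mw k) (w0 k) mwk wk0 _ _ (IH us))//.
  - by apply: mdensityM; [move=> t; rewrite big_cons mulrC|exact: measurable_box].
  - by move=> i ik; rewrite /nus inE (negbTE ik).
  - by move=> A mA; rewrite /nus mem_head (negbTE ks); exact: nu'E.
have := tilted _ (index_enum_uniq 'I_n); congr product_law.
by apply/funext => i; rewrite /nus mem_index_enum.
Qed.

End product_law_mdensity.

(** * Gaussian laws *)

Section normal_prob.
Local Open Scope ereal_scope.
Context {R : realType}.
Implicit Types (m a b h s x : R) (A : set R).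
Notation leb := (@lebesgue_measure R).

Let measurable_add h :
  measurable_fun [set: measurableTypeR R] (fun x => (x + h)%R : measurableTypeR R).
Proof. exact: measurable_funD. Qed.

Lemma lebesgue_measure_shift h A : measurable A ->
  leb ((fun x => (x + h)%R) @^-1` A) = leb A.
Proof.
move=> mA; change (pushforward leb (fun x => (x + h)%R : measurableTypeR R) A = leb A).
apply/esym/lebesgue_measure_unique => //= _ [[a b]] _ <-.
rewrite /pushforward (_ : _ @^-1` _ = `](a - h)%R, (b - h)%R]%classic).
  rewrite !lebesgue_measure_itv/= !lte_fin ltrD2r.
  by case: ifP => // _; rewrite -!EFinB; congr EFin; lra.
by apply/seteqP; split=> x /=; rewrite !in_itv/= ltrBlDr lerBrDr.
Qed.

Lemma normal_prob_shift m h s A : s != 0%R -> measurable A ->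
  normal_prob m s ((fun x => (x + h)%R) @^-1` A) = normal_prob (m + h) s A.
Proof.
move=> s0 mA; rewrite /normal_prob.
transitivity (\int[pushforward leb (fun x => (x + h)%R : measurableTypeR R)]_(x in A)
    (normal_pdf (m + h) s x)%:E); last first.
  by apply: eq_measure_integral => B mB _; exact: lebesgue_measure_shift.
apply: etrans (esym (ge0_integral_pushforward (measurable_add h) _ mA _ _)).
- apply: eq_integral => x _; rewrite /= !normal_pdfE// /normal_fun.
  by rewrite opprD addrACA subrr addr0.
- by apply: measurable_funTS; apply/measurable_EFinP; exact: measurable_normal_pdf.
- by move=> x _; rewrite lee_fin normal_pdf_ge0.
Qed.

Definition normal_ratio a b s x : R :=
  expR ((b - a) * x / s ^+ 2 - (b ^+ 2 - a ^+ 2) / (2 * s ^+ 2)).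

Lemma measurable_normal_ratio a b s : measurable_fun setT (normal_ratio a b s).
Proof.
apply: measurableT_comp => //; apply: measurable_funB => //.
by apply: measurable_funM => //; exact: measurable_funM.
Qed.

Lemma normal_ratio_ge0 a b s x : (0 <= normal_ratio a b s x)%R.
Proof. exact: expR_ge0. Qed.

Lemma normal_pdfM a b s x : s != 0%R ->
  normal_pdf b s x = (normal_pdf a s x * normal_ratio a b s x)%R.
Proof.
move=> s0; rewrite !normal_pdfE//= -[RHS]mulrA /normal_fun /normal_ratio -expRD.
by congr (_ * expR _)%R; rewrite -mulr_natl; field.
Qed.

Lemma normal_prob_mdensity a b s A : s != 0%R -> measurable A ->
  normal_prob b s A =
  mdensity (normal_prob a s) (measurable_normal_ratio a b s) (normal_ratio_ge0 a b s) A.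
Proof.
move=> s0 mA; pose leb_pdf m := mdensity leb (measurable_normal_pdf m s) (normal_pdf_ge0 m s).
transitivity (mdensity (leb_pdf a) (measurable_normal_ratio a b s) (normal_ratio_ge0 a b s) A).
  rewrite (_ : normal_prob b s A = leb_pdf b A)//.
  by apply: mdensityM => // x; exact: normal_pdfM.
exact: eq_mdensity.
Qed.

(* [normal_prob] lives on [measurableTypeR R]; tuples of reals need its transport to
   the canonical measurable structure of [R]. *)
Lemma measurable_idfun_measurableTypeR : (idfun : measurableTypeR R -> R) \in mfun.
Proof. by rewrite inE; exact: measurable_id. Qed.

Definition normal_law m s : probability R R :=
  distribution (normal_prob m s) (mfun_Sub measurable_idfun_measurableTypeR).

Lemma normal_law_shift m h s A : s != 0%R -> measurable A ->
  normal_law m s ((fun x => (x + h)%R) @^-1` A) = normal_law (m + h) s A.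
Proof. by move=> s0 mA; exact: normal_prob_shift. Qed.

Lemma normal_law_mdensity a b s A : s != 0%R -> measurable A ->
  normal_law b s A =
  mdensity (normal_law a s) (measurable_normal_ratio a b s) (normal_ratio_ge0 a b s) A.
Proof.
move=> s0 mA; rewrite mdensityE ge0_integral_distribution.
- exact: etrans (normal_prob_mdensity a b s0 mA) (mdensityE _ _ _ _).
- by apply/measurable_EFinP; apply: measurable_funM => //; exact: measurable_normal_ratio.
- by move=> x; rewrite lee_fin mulr_ge0 ?normal_ratio_ge0.
Qed.

End normal_prob.

Section dot_product.
Context {R : realType} (n : nat).
Implicit Types (a : R) (u v w : 'cV[R]_n).

Definition dot u v : R := \sum_i u i 0 * v i 0.

Lemma dotE u v : dot u v = (u^T *m v) 0 0.
Proof. by rewrite mxE; apply: eq_bigr => i _; rewrite mxE. Qed.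

Lemma sqnormE u : sqnorm u = dot u u.
Proof. by apply: eq_bigr => i _; rewrite expr2. Qed.

Lemma dotC u v : dot u v = dot v u.
Proof. by apply: eq_bigr => i _; rewrite mulrC. Qed.

Lemma dotDr u v w : dot u (v + w) = dot u v + dot u w.
Proof. by rewrite !dotE mulmxDr mxE. Qed.

Lemma dotDl u v w : dot (u + v) w = dot u w + dot v w.
Proof. by rewrite ![dot _ w]dotC dotDr. Qed.

Lemma dotZr a u v : dot u (a *: v) = a * dot u v.
Proof. by rewrite !dotE -scalemxAr mxE. Qed.

Lemma dotZl a u v : dot (a *: u) v = a * dot u v.
Proof. by rewrite ![dot _ v]dotC dotZr. Qed.

Lemma dotNr u v : dot u (- v) = - dot u v.
Proof. by rewrite -scaleN1r dotZr mulN1r. Qed.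

Lemma dotNl u v : dot (- u) v = - dot u v.
Proof. by rewrite ![dot _ v]dotC dotNr. Qed.

Definition dot_simp := (dotDr, dotDl, dotNr, dotNl, dotZr, dotZl).

End dot_product.

Lemma dot_mulmx (R : realType) m n (A : 'M[R]_(m, n)) u v :
  dot (A *m u) v = dot u (A^T *m v).
Proof. by rewrite !dotE trmx_mul mulmxA. Qed.

Section gauss_law.
Context {R : realType} (n : nat).
Variable sigma : R.
Implicit Types (m a b h : 'cV[R]_n) (t : n.-tuple R).

Definition gauss_law m (Q : set (n.-tuple R) -> \bar R) : Prop :=
  product_law (fun i => normal_law (m i 0) sigma) Q.

Definition tshift h t : n.-tuple R := [tuple tnth t i + h i 0 | i < n].

Lemma tcol_tshift h t : tcol (tshift h t) = h + tcol t.
Proof. by apply/colP => i; rewrite !mxE tnth_mktuple addrC. Qed.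

Lemma measurable_tshift h : measurable_fun setT (tshift h).
Proof.
apply/measurable_fun_tnthP => i.
rewrite (_ : _ \o _ = (fun t => tnth t i + h i 0)).
  by apply: measurable_funD => //; exact: measurable_tnth.
by apply/funext => t /=; rewrite tnth_mktuple.
Qed.

Lemma measurable_dot_tcol m : measurable_fun setT (fun t => dot m (tcol t)).
Proof.
apply: measurable_sum => i; under eq_fun do rewrite mxE.
by apply: measurable_funM => //; exact: measurable_tnth.
Qed.

Hypothesis sigma_neq0 : sigma != 0.

Lemma gauss_law_tshift m h Q :
  gauss_law m Q -> gauss_law (m + h) (pushforward Q (tshift h)).
Proof.
move=> Qm B mB; pose Bh i := (fun x => x + h i 0) @^-1` B i.
have mBh i : measurable (Bh i).
  have mh : measurable_fun [set: R] (fun x : R => x + h i 0) by exact: measurable_funD.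
  by rewrite -(setTI (Bh i)); apply: mh; [exact: measurableT|exact: mB].
have -> : pushforward Q (tshift h) (box B) = Q (box Bh).
  by congr Q; apply/seteqP; split=> t Bt i; have := Bt i; rewrite /Bh/= tnth_mktuple.
rewrite (Qm _ mBh); apply: congr1; apply: eq_bigr => i _; rewrite mxE.
exact: congr1 (normal_law_shift (m i 0) (h i 0) sigma_neq0 (mB i)).
Qed.

(* The density of the law of mean b with respect to the law of mean a. *)
Definition gauss_ratio a b t : R :=
  expR (dot (b - a) (tcol t) / sigma ^+ 2 - (sqnorm b - sqnorm a) / (2 * sigma ^+ 2)).

Lemma gauss_ratio_ge0 a b t : 0 <= gauss_ratio a b t.
Proof. exact: expR_ge0. Qed.

Lemma measurable_gauss_ratio a b : measurable_fun setT (gauss_ratio a b).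
Proof.
apply: measurableT_comp => //; apply: measurable_funB => //.
by apply: measurable_funM => //; exact: measurable_dot_tcol.
Qed.

Lemma gauss_ratioE a b t :
  gauss_ratio a b t = \prod_i normal_ratio (a i 0) (b i 0) sigma (tnth t i).
Proof.
rewrite -expR_sum; congr expR; rewrite big_split/= sumrN -!mulr_suml sumrB.
by congr (_ / _ - _); apply: eq_bigr => i _; rewrite !mxE.
Qed.

Theorem cameron_martin a b (Qa Qb : {measure set (n.-tuple R) -> \bar R}) F v :
  gauss_law a Qa -> gauss_law b Qb -> measurable_fun setT F ->
  has_integral Qb F v <-> has_integral Qa (fun t => gauss_ratio a b t * F t) v.
Proof.
move=> aQa bQb mF.
apply: (has_integral_change (phi := id) _ (measurable_gauss_ratio a b)
  (gauss_ratio_ge0 a b)) => // f mf f0.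
rewrite -ge0_integral_mdensity//; [exact: measurable_gauss_ratio|exact: gauss_ratio_ge0|].
move=> mr r0; apply: eq_measure_integral => A mA _.
apply: (product_law_unique bQb) mA => B mB.
have := product_law_mdensity
  (fun i C mC => normal_law_mdensity (a i 0) (b i 0) sigma_neq0 mC) aQa.
move=> /(_ B mB) <-; apply: eq_integral => t _.
by rewrite gauss_ratioE.
Qed.

End gauss_law.

(** * Hermite polynomials and Gaussian moments *)

Section gauss_smooth.
Context {R : realType}.
Implicit Types (p q : {poly R}) (c t : R).

(* For Z a standard normal variable, [(gauss_smooth q).[t]] is E [q (Z + t)]: a
   factor [Z + t] amounts to the operator [p |-> 'X * p + p^`()]. *)
Definition gauss_smooth q : {poly R} :=
  foldr (fun c p => 'X * p + p^`() + c%:P) 0 q.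

Lemma gauss_smooth0 : gauss_smooth 0 = 0.
Proof. by rewrite /gauss_smooth polyseq0. Qed.

Lemma gauss_smooth_cons q c :
  gauss_smooth (q * 'X + c%:P) = 'X * gauss_smooth q + (gauss_smooth q)^`() + c%:P.
Proof.
rewrite -cons_poly_def /gauss_smooth polyseq_cons; case: nilP => //= q0.
rewrite polyseqC; have -> : q = 0 by apply/eqP; rewrite -size_poly_eq0 q0.
by case: eqP => [->|_] /=; rewrite ?mulr0 ?deriv0 ?polyseq0/= ?mulr0 ?deriv0 ?add0r.
Qed.

Lemma gauss_smooth1 : gauss_smooth 1 = 1.
Proof.
by have := gauss_smooth_cons 0 1; rewrite mul0r gauss_smooth0 mulr0 deriv0 !add0r.
Qed.

Lemma gauss_smoothX q : gauss_smooth (q * 'X) = 'X * gauss_smooth q + (gauss_smooth q)^`().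
Proof. by have := gauss_smooth_cons q 0; rewrite !addr0. Qed.

Lemma gauss_smooth_is_linear : linear gauss_smooth.
Proof.
move=> a p; elim/poly_ind: p => [|p c IH] q.
  by rewrite scaler0 gauss_smooth0 scaler0 !add0r.
have [q' [c' ->]] : exists q' c', q = q' * 'X + c'%:P.
  elim/poly_ind: q => [|q c' _]; first by exists 0, 0; rewrite mul0r addr0.
  by exists q, c'.
rewrite scalerDr addrACA scalerAl -mulrDl scale_polyC -polyCD !gauss_smooth_cons IH.
rewrite polyCD derivD derivZ -!mul_polyC polyCM; ring.
Qed.

HB.instance Definition _ :=
  GRing.isLinear.Build R {poly R} {poly R} *:%R gauss_smooth gauss_smooth_is_linear.

Lemma deriv_gauss_smooth q : (gauss_smooth q)^`() = gauss_smooth q^`().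
Proof.
elim/poly_ind: q => [|q c IH]; first by rewrite gauss_smooth0 !deriv0 gauss_smooth0.
rewrite gauss_smooth_cons !derivD !derivM derivX !derivC linearD linear0/=.
rewrite mulr1 linearD/= gauss_smoothX -IH; ring.
Qed.

Fixpoint hermite (k : nat) : {poly R} :=
  if k is j.+1 then hermite j * 'X - (hermite j)^`() else 1.

Lemma hermiteS k : hermite k.+1 = hermite k * 'X - (hermite k)^`().
Proof. by []. Qed.

Lemma deriv_hermite k : (hermite k.+1)^`() = hermite k *+ k.+1.
Proof.
elim: k => [|k IH]; first by rewrite /= mul1r derivB derivX !derivC subr0.
rewrite hermiteS derivB derivM derivX mulr1 IH derivMn mulrnAl addrAC -mulrnBl.
by rewrite -hermiteS -mulrSr.
Qed.

Lemma gauss_smooth_hermiteSM k q : gauss_smooth (hermite k.+1 * q) =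
  'X * gauss_smooth (hermite k * q) + gauss_smooth (hermite k * q^`()).
Proof.
rewrite hermiteS mulrBl mulrAC linearB/= gauss_smoothX deriv_gauss_smooth derivM linearD/=; ring.
Qed.

Lemma gauss_smooth_hermite k : gauss_smooth (hermite k) = 'X^k.
Proof.
elim: k => [|k IH]; first exact: gauss_smooth1.
by rewrite -[hermite _]mulr1 gauss_smooth_hermiteSM derivC mulr0 mulr1 IH linear0 addr0 exprS.
Qed.

Lemma gauss_smooth_hermiteM k j :
  (gauss_smooth (hermite k * hermite j)).[0] = if k == j then k`!%:R else 0.
Proof.
elim: k j => [|k IH] j.
  by rewrite mul1r gauss_smooth_hermite hornerXn expr0n eq_sym; case: eqP.
rewrite gauss_smooth_hermiteSM hornerD hornerM hornerX mul0r add0r.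
case: j => [|j]; first by rewrite derivC mulr0 linear0 horner0.
rewrite deriv_hermite mulrnAr linearMn hornerMn IH eqSS.
by case: eqP => [<-|_]; rewrite ?mul0rn// factS natrM mulr_natl.
Qed.

End gauss_smooth.

Section exponential_moments.
Context d (T : measurableType d) (R : realType) (mu : {measure set T -> \bar R}).
Implicit Types (a b : R).

Lemma normrMX_expR_le a b (x y : R) : `|b - a| <= 1 ->
  `|y * x * expR (b * x)| <= `|y * expR ((a + 2) * x)| + `|y * expR ((a - 2) * x)|.
Proof.
move=> ba1; rewrite !normrM !(@ger0_norm _ (expR _)) ?expR_ge0//.
rewrite -mulrDr -mulrA ler_wpM2l//.
apply: (@le_trans _ _ (expR (a * x + 2 * `|x|))).
  apply: (@le_trans _ _ (expR `|x| * expR (a * x + `|x|))).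
    apply: ler_pM; rewrite ?expR_ge0//.
      by apply: le_trans (expR_ge1Dx _); rewrite lerDr.
    rewrite ler_expR -lerBlDl -mulrBl (le_trans (ler_norm _))// normrM.
    by rewrite ler_piMl.
  by rewrite -expRD ler_expR; lra.
have [x0|x0] := leP 0 x; first by rewrite ger0_norm// -mulrDl lerDl expR_ge0.
by rewrite ltr0_norm// mulrN -mulNr -mulrDl lerDr expR_ge0.
Qed.

Variables (X Y : T -> R).
Hypotheses (mX : measurable_fun setT X) (mY : measurable_fun setT Y).
Hypothesis iYX : forall a, mu.-integrable setT (EFin \o (fun x => Y x * expR (a * X x))).

Let bound a x := `|Y x * expR ((a + 2) * X x)| + `|Y x * expR ((a - 2) * X x)|.

Let integrable_bound a : mu.-integrable setT (EFin \o bound a).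
Proof.
exact: (integrableD measurableT (integrable_norm (iYX _)) (integrable_norm (iYX _))).
Qed.

Lemma integrableMX_expR a :
  mu.-integrable setT (EFin \o (fun x => Y x * X x * expR (a * X x))).
Proof.
apply: le_normr_integrable (integrable_bound a).
- apply: measurable_funM; first exact: measurable_funM.
  by apply: measurableT_comp => //; exact: measurable_funM.
- by move=> x; apply: normrMX_expR_le; rewrite subrr normr0.
Qed.

Lemma is_derive_integral_expR a :
  is_derive a 1 (fun b => \int[mu]_x (Y x * expR (b * X x)))
    (\int[mu]_x (Y x * X x * expR (a * X x))).
Proof.
pose f b x := Y x * expR (b * X x).
have df b x : is_derive b 1 (f^~ x) (Y x * X x * expR (b * X x)).
  have dX : is_derive b 1 (fun b : R => b * X x) (X x).
    by apply: is_derive_eq; rewrite /GRing.scale/=; ring.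
  have dexp := @is_derive1_comp R expR _ b _ _ (is_derive_expR _) dX.
  by apply: (is_derive_eq (is_deriveZ (Y x) dexp)); rewrite /GRing.scale/=; ring.
have Ia : `]a - 1, a + 1[%classic a by rewrite /= in_itv/= ltrBlDr !ltrDl ltr01.
have bound0 x : 0 <= bound a x by rewrite addr_ge0.
have d1fE b x : partial1of2 f b x = Y x * X x * expR (b * X x).
  by rewrite partial1of2E; apply: derive_val.
have d1f_le b x : `]a - 1, a + 1[%classic b -> [set: T] x -> `|partial1of2 f b x| <= bound a x.
  rewrite /= in_itv/= d1fE => /andP[ab ba] _; apply: normrMX_expR_le.
  by rewrite ler_norml; apply/andP; split; lra.
have ex_df b x : `]a - 1, a + 1[%classic b -> [set: T] x -> derivable (f^~ x) b 1.
  by move=> _ _; exact: ex_derive.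
have integrable_f b : `]a - 1, a + 1[%classic b -> mu.-integrable setT (EFin \o f b).
  by move=> _; exact: iYX.
apply: DeriveDef.
  exact: (derivable_under_integral measurableT Ia integrable_f ex_df bound0
    (integrable_bound a) d1f_le).
rewrite -derive1E (differentiation_under_integral measurableT Ia integrable_f ex_df bound0
  (integrable_bound a) d1f_le).
by apply: eq_Rintegral => x _; rewrite d1fE.
Qed.

End exponential_moments.

Lemma is_derive_expR_sqr (R : realType) (t : R) :
  is_derive t 1 (fun t : R => expR (t ^+ 2 / 2)) (t * expR (t ^+ 2 / 2)).
Proof.
have dsqr : is_derive t 1 (fun t : R => t ^+ 2 / 2) t.
  by apply: is_derive_eq; rewrite /GRing.scale/=; field.
by apply: (is_derive_eq (@is_derive1_comp R expR _ t _ _ (is_derive_expR _) dsqr)); rewrite mulrC.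
Qed.

Section gaussian_moments.
Context d (T : measurableType d) (R : realType) (mu : {measure set T -> \bar R}).

Lemma measurable_horner (q : {poly R}) : measurable_fun setT (horner q).
Proof. by apply: continuous_measurable_fun => x; exact: continuous_horner. Qed.

Lemma has_integral_poly_expR (X Y : T -> R) (c : R) (q : {poly R}) :
  measurable_fun setT X -> measurable_fun setT Y ->
  (forall a, has_integral mu (fun x => Y x * expR (a * X x)) (c * expR (a ^+ 2 / 2))) ->
  forall a, has_integral mu (fun x => Y x * q.[X x] * expR (a * X x))
    (c * ((gauss_smooth q).[a] * expR (a ^+ 2 / 2))).
Proof.
move=> mX mY mgf; elim/poly_ind: q => [|q c' IH] a.
  have := has_integralZl 0 (mgf a); rewrite gauss_smooth0 !horner0 !mul0r mulr0.
  by congr has_integral; apply/funext => x; rewrite horner0 mulr0 !mul0r.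
have mYq : measurable_fun setT (fun x => Y x * q.[X x]).
  by apply: measurable_funM => //; exact: (measurableT_comp (measurable_horner q) mX).
have iYq b := (IH b).1.
have [_ dq] : is_derive a 1 (fun b => \int[mu]_x (Y x * q.[X x] * expR (b * X x)))
    (c * ((gauss_smooth (q * 'X)).[a] * expR (a ^+ 2 / 2))).
  rewrite (_ : (fun b => _) = (fun b => c *: ((gauss_smooth q).[b] * expR (b ^+ 2 / 2)))).
    have dexp := is_derive_expR_sqr a.
    apply: is_derive_eq; rewrite gauss_smoothX /GRing.scale/= hornerD hornerM hornerX; ring.
  by apply/funext => b; have [_ ->] := IH b.
have [_ dq'] := is_derive_integral_expR iYq a.
have int_qX : has_integral mu (fun x => Y x * q.[X x] * X x * expR (a * X x))
    (c * ((gauss_smooth (q * 'X)).[a] * expR (a ^+ 2 / 2))).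
  by rewrite -dq dq'; split; [exact: integrableMX_expR|].
have := has_integralD int_qX (has_integralZl c' (mgf a)).
congr has_integral; last by rewrite gauss_smooth_cons gauss_smoothX !hornerD hornerC; ring.
by apply/funext => x; rewrite hornerD hornerM hornerX hornerC; ring.
Qed.

End gaussian_moments.

(* The hypothesis on the moment generating function says that the w_l are
   independent standard normal variables. *)
Section gaussian_vector.
Context d (T : measurableType d) (R : realType) (mu : {measure set T -> \bar R}).
Variables (D : nat) (w : 'I_D -> T -> R).
Hypothesis mw : forall l, measurable_fun setT (w l).
Hypothesis mgf : forall t : 'I_D -> R,
  has_integral mu (fun x => expR (\sum_l t l * w l x)) (expR (\sum_l t l ^+ 2 / 2)).

Lemma measurable_prod_horner (s : seq 'I_D) (q : 'I_D -> {poly R}) :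
  measurable_fun setT (fun x => \prod_(l <- s) (q l).[w l x]).
Proof.
apply: measurable_prod => l _.
exact: (measurableT_comp (measurable_horner (q l)) (mw l)).
Qed.

Lemma measurable_expR_sum (A : pred 'I_D) (t : 'I_D -> R) :
  measurable_fun setT (fun x => expR (\sum_(l | A l) t l * w l x)).
Proof.
apply: measurableT_comp => //; under eq_fun do rewrite big_mkcond.
by apply: measurable_sum => l; case: (A l) => //; exact: measurable_funM.
Qed.

Theorem has_integral_prod_poly_expR (q : 'I_D -> {poly R}) (t : 'I_D -> R) :
  has_integral mu (fun x => (\prod_l (q l).[w l x]) * expR (\sum_l t l * w l x))
    ((\prod_l (gauss_smooth (q l)).[t l]) * expR (\sum_l t l ^+ 2 / 2)).
Proof.
suff prod_seq (s : seq 'I_D) : uniq s -> forall t : 'I_D -> R,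
    has_integral mu (fun x => (\prod_(l <- s) (q l).[w l x]) * expR (\sum_l t l * w l x))
      ((\prod_(l <- s) (gauss_smooth (q l)).[t l]) * expR (\sum_l t l ^+ 2 / 2)).
  exact: prod_seq (index_enum_uniq 'I_D) t.
elim: s {t} => [_ t|k s IH /= /andP[ks us] t].
  by have := mgf t; congr has_integral; [apply/funext => x|]; rewrite big_nil mul1r.
pose Y x := (\prod_(l <- s) (q l).[w l x]) * expR (\sum_(l | l != k) t l * w l x).
pose c := (\prod_(l <- s) (gauss_smooth (q l)).[t l]) * expR (\sum_(l | l != k) t l ^+ 2 / 2).
have mY : measurable_fun setT Y.
  by apply: measurable_funM; [exact: measurable_prod_horner|exact: measurable_expR_sum].
have mgfY a : has_integral mu (fun x => Y x * expR (a * w k x)) (c * expR (a ^+ 2 / 2)).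
  pose ta l := if l == k then a else t l.
  have ta_sum (F : R -> 'I_D -> R) :
      \sum_l F (ta l) l = F a k + \sum_(l | l != k) F (t l) l.
    by rewrite (bigD1 k)//= /ta eqxx; congr (_ + _); apply: eq_bigr => l /negbTE ->.
  have := IH us ta; congr has_integral; [apply/funext => x|].
    by rewrite /Y -mulrA -expRD (ta_sum (fun b l => b * w l x)) addrC.
  rewrite /c -mulrA -expRD (ta_sum (fun b _ => b ^+ 2 / 2)) addrC; congr (_ * _).
  by apply: eq_big_seq => l ls; rewrite /ta ifN//; apply: contraNneq ks => <-.
have := has_integral_poly_expR (q k) (mw k) mY mgfY (t k).
congr has_integral; [apply/funext => x|];
  rewrite big_cons [in RHS](bigD1 k)//= expRD ?/Y ?/c; ring.
Qed.

End gaussian_vector.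

(** * Sums over exhaustions *)

Section exhaustion.
Context {R : realType} (T : choiceType) (B : nat -> seq T).

Definition exhaustion : Prop :=
  [/\ forall n, uniq (B n), forall m n, (m <= n)%N -> {subset B m <= B n}
    & forall p, exists n, p \in B n].

Hypothesis exB : exhaustion.
Implicit Types (f : T -> R).

Lemma exhaustion_near p : \forall n \near \oo, p \in B n.
Proof.
have [_ ndB /(_ p)[m pm]] := exB.
by exists m => // n /= mn; exact: (ndB m n mn).
Qed.

Lemma exhaustion_subset (s : seq T) : \forall n \near \oo, {subset s <= B n}.
Proof.
elim: s => [|p s IH]; first exact: nearW.
apply: filterS2 (exhaustion_near p) IH => n pn sn q.
by rewrite inE => /orP[/eqP ->//|]; exact: sn.
Qed.

Lemma ler_sum_subset (s1 s2 : seq T) f : (forall p, 0 <= f p) -> uniq s1 ->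
  uniq s2 -> {subset s1 <= s2} -> \sum_(p <- s1) f p <= \sum_(p <- s2) f p.
Proof.
move=> f0 us1 us2 s12; rewrite [leRHS](bigID (mem s1))/= -[X in _ <= X + _]big_filter.
rewrite [X in _ <= X + _](perm_big s1) ?lerDl ?sumr_ge0//.
by apply: uniq_perm; rewrite ?filter_uniq// => p; rewrite mem_filter /= andb_idr//; exact: s12.
Qed.

Lemma sum_le_esum f n :
  ((\sum_(p <- B n) f p)%:E <= \esum_(p in setT) (f p)%:E)%E.
Proof.
have [uB _ _] := exB; apply: esum_ge; exists [set` B n].
  by split => //; exact: finite_seq.
by rewrite -fsbig_seq// sumEFin.
Qed.

Lemma cvg_sum_esum f : (forall p, 0 <= f p) ->
  (\sum_(p <- B n) f p)%:E @[n --> \oo] --> (\esum_(p in setT) (f p)%:E)%E.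
Proof.
move=> f0; have [uB ndB _] := exB.
have nd_sum : nondecreasing_seq (fun n => (\sum_(p <- B n) f p)%:E).
  by move=> m n mn; rewrite lee_fin; apply: ler_sum_subset => //; exact: ndB.
have := ereal_nondecreasing_cvgn nd_sum; congr (_ --> _).
apply/eqP; rewrite eq_le; apply/andP; split.
  by apply: ge_ereal_sup => _ [n _ <-]; exact: sum_le_esum.
apply: ge_ereal_sup => _ [A [finA _] <-].
have [n _ /(_ n (leqnn n)) /= subB] := exhaustion_subset (finmap.enum_fset (fset_set A)).
apply: (@le_trans _ _ (\sum_(p <- B n) f p)%:E); last by apply: ereal_sup_ubound; exists n.
rewrite fsbig_finite//= sumEFin lee_fin.
by apply: ler_sum_subset => //; exact: finmap.fset_uniq.
Qed.

Lemma esum_le f C : (forall p, 0 <= f p) -> (forall n, \sum_(p <- B n) f p <= C) ->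
  (\esum_(p in setT) (f p)%:E <= C%:E)%E.
Proof.
move=> f0 fC; have cf := cvg_sum_esum f0; rewrite -(cvg_lim _ cf)//.
apply: lime_le; first by apply/cvg_ex; eexists; exact: cf.
by apply: nearW => n; rewrite lee_fin.
Qed.

Lemma cvg_sum_fine_esum f : (forall p, 0 <= f p) ->
  (\esum_(p in setT) (f p)%:E < +oo)%E ->
  \sum_(p <- B n) f p @[n --> \oo] --> fine (\esum_(p in setT) (f p)%:E)%E.
Proof.
move=> f0 foo; have := cvg_sum_esum f0.
rewrite -[X in _ --> X]fineK; first by move/fine_cvg.
by rewrite ge0_fin_numE//; apply: esum_ge0 => p _; rewrite lee_fin.
Qed.

Lemma cvg_sum_usum f : (\esum_(p in setT) `|f p|%:E < +oo)%E ->
  \sum_(p <- B n) f p @[n --> \oo] --> usum f.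
Proof.
move=> foo; have maxoo g : (forall p, 0 <= g p <= `|f p|) ->
    (\esum_(p in setT) (g p)%:E < +oo)%E.
  by move=> gf; apply: le_lt_trans foo; apply: le_esum => p _; rewrite lee_fin; case/andP: (gf p).
have f_pos p : 0 <= Num.max (f p) 0 <= `|f p|.
  by rewrite le_max lexx orbT ge_max normr_ge0 ler_norm.
have f_neg p : 0 <= Num.max (- f p) 0 <= `|f p|.
  by rewrite le_max lexx orbT ge_max normr_ge0 -normrN ler_norm.
have -> : (fun n => \sum_(p <- B n) f p) = (fun n =>
    \sum_(p <- B n) Num.max (f p) 0 - \sum_(p <- B n) Num.max (- f p) 0).
  apply/funext => n; rewrite -sumrB; apply: eq_bigr => p _.
  by rewrite /Num.max; case: ltrP => ?; case: ltrP => ?; lra.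
by apply: cvgB; apply: cvg_sum_fine_esum => [p|];
  [case/andP: (f_pos p)|exact: maxoo|case/andP: (f_neg p)|exact: maxoo].
Qed.

Lemma esumZl k f : (forall p, 0 <= f p) -> 0 <= k ->
  (\esum_(p in setT) (k * f p)%:E = k%:E * \esum_(p in setT) (f p)%:E)%E.
Proof.
move=> f0 k0; have kf0 p : 0 <= k * f p by exact: mulr_ge0.
rewrite -(cvg_lim _ (cvg_sum_esum kf0))//; apply/cvg_lim => //.
under eq_fun do rewrite -mulr_sumr EFinM.
by apply: cvgeZl => //; exact: cvg_sum_esum.
Qed.

Lemma usumZl k f : 0 < k -> usum (fun p => k * f p) = k * usum f.
Proof.
move=> k0; have fineZ (y : \bar R) : fine (k%:E * y)%E = k * fine y.
  by case: y => [r| |] //=; rewrite ?gt0_muley ?gt0_muleNy ?lte_fin ?mulr0.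
have max0 (g : T -> R) : \esum_(p in setT) (Num.max (k * g p) 0)%:E =
    (k%:E * \esum_(p in setT) (Num.max (g p) 0)%:E)%E.
  rewrite -(@esumZl k (fun p => Num.max (g p) 0)) ?(ltW k0)// => [|p]; last first.
    by rewrite le_max lexx orbT.
  by apply: eq_esum => p _; rewrite maxr_pMr ?(ltW k0)// mulr0.
rewrite /usum max0 [X in _ - fine X = _](eq_esum (b := fun p => (Num.max (k * - f p) 0)%:E)).
  by rewrite (max0 (fun p => - f p)) !fineZ mulrBr.
by move=> p _; rewrite mulrN.
Qed.

End exhaustion.

Section square_summable.
Context {R : realType} (T : choiceType).
Implicit Types (a b : T -> R).

Definition sqsummable a : Prop := (\esum_(p in setT) (a p ^+ 2)%:E < +oo)%E.

Definition sqsum a : R := fine (\esum_(p in setT) (a p ^+ 2)%:E).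

Lemma sqsummableM a b : sqsummable a -> sqsummable b ->
  (\esum_(p in setT) `|a p * b p|%:E < +oo)%E.
Proof.
move=> a_l2 b_l2; apply: (@le_lt_trans _ _
    (\esum_(p in setT) ((a p ^+ 2)%:E + (b p ^+ 2)%:E))%E).
  apply: le_esum => p _; rewrite -EFinD lee_fin normrM.
  rewrite -(real_normK (num_real (a p))) -(real_normK (num_real (b p))).
  have := sqr_ge0 (`|a p| - `|b p|); have := normr_ge0 (a p); have := normr_ge0 (b p).
  by move=> ? ? ?; nra.
by rewrite esumD ?lte_add_pinfty// => p _; rewrite lee_fin sqr_ge0.
Qed.

Lemma sqsummable_bound (B : nat -> seq T) a C : exhaustion B ->
  (forall n, \sum_(p <- B n) a p ^+ 2 <= C) -> sqsummable a /\ sqsum a <= C.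
Proof.
move=> exB aC; have a0 p : 0 <= a p ^+ 2 by exact: sqr_ge0.
have le_C := esum_le exB a0 aC.
have a_l2 : sqsummable a by rewrite /sqsummable (le_lt_trans le_C)// ltry.
split=> //; rewrite -lee_fin fineK// ge0_fin_numE//.
by apply: esum_ge0 => p _; rewrite lee_fin.
Qed.

End square_summable.

Section mindex_box.
Variable D : nat.

Definition mindex_box (K : nat) : seq (mindex D) :=
  [seq ([ffun l => val (q l)] : mindex D) | q : {ffun 'I_D -> 'I_K.+1}].

Lemma mem_mindex_box K p : (p \in mindex_box K) = [forall l, (p l <= K)%N].
Proof.
apply/mapP/forallP => [[q _ ->] l|pK]; first by rewrite ffunE -ltnS ltn_ord.
exists [ffun l => inord (p l)]; first by rewrite mem_enum.
by apply/ffunP => l; rewrite !ffunE/= inordK// ltnS.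
Qed.

Lemma exhaustion_mindex_box : exhaustion mindex_box.
Proof.
split=> [K|K K' KK' p|p].
- rewrite map_inj_uniq ?enum_uniq// => q q' /ffunP qq'; apply/ffunP => l.
  by have := qq' l; rewrite !ffunE => /val_inj.
- rewrite !mem_mindex_box => /forallP pK; apply/forallP => l.
  exact: leq_trans (pK l) KK'.
- by exists (\max_l p l); rewrite mem_mindex_box; apply/forallP => l; exact: leq_bigmax.
Qed.

Lemma big_mindex_box (V : nmodType) (f : mindex D -> V) K :
  \sum_(q : {ffun 'I_D -> 'I_K.+1}) f [ffun l => val (q l)] =
  \sum_(p <- mindex_box K) f p.
Proof. by rewrite big_image. Qed.

End mindex_box.

(** * Square integrable functions *)

Section L2.
Context d (T : measurableType d) (R : realType) (mu : {measure set T -> \bar R}).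
Implicit Types (X Y Z : T -> R) (a : R).

Definition L2 : {pred T -> R} := Lfun mu 2%:E.

HB.instance Definition _ := GRing.isSubmodClosed.Build R (T -> R) L2
  (Lfun_submod_closed mu (lee1n 2)).

Lemma L2P X : X \in L2 <->
  measurable_fun setT X /\ (\int[mu]_x (X x ^+ 2)%:E < +oo)%E.
Proof.
split=> [XL2|[mX XL2]].
  split; first by have := sub_Lfun_mfun XL2; rewrite inE.
  by have /integrable_lty := Lfun2_integrable_sqr XL2; exact.
rewrite inE; apply/andP; split; rewrite inE//= /finite_norm unlock.
apply: poweR_lty; rewrite (eq_integral (fun x => (X x ^+ 2)%:E))// => x _.
by rewrite /= powR_mulrn// real_normK ?num_real.
Qed.

Lemma measurable_L2 X : X \in L2 -> measurable_fun setT X.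
Proof. by move=> /L2P[]. Qed.

Definition inner X Y : R := \int[mu]_x (X x * Y x).

Lemma has_integral_inner X Y : X \in L2 -> Y \in L2 ->
  has_integral mu (fun x => X x * Y x) (inner X Y).
Proof.
by move=> XL2 YL2; split=> //; exact/Lfun1_integrable/Lfun2_mul_Lfun1.
Qed.

Lemma innerC X Y : inner X Y = inner Y X.
Proof. by apply: eq_Rintegral => x _; rewrite mulrC. Qed.

Lemma innerDr X Y Z : X \in L2 -> Y \in L2 -> Z \in L2 ->
  inner X (Y + Z) = inner X Y + inner X Z.
Proof.
move=> XL2 YL2 ZL2; have [_ <-] :=
  has_integralD (has_integral_inner XL2 YL2) (has_integral_inner XL2 ZL2).
by apply: eq_Rintegral => x _; rewrite -mulrDr.
Qed.

Lemma innerZr a X Y : X \in L2 -> Y \in L2 -> inner X (a *: Y) = a * inner X Y.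
Proof.
move=> XL2 YL2; have [_ <-] := has_integralZl a (has_integral_inner XL2 YL2).
by apply: eq_Rintegral => x _; rewrite -mulrCA.
Qed.

Lemma innerBr X Y Z : X \in L2 -> Y \in L2 -> Z \in L2 ->
  inner X (Y - Z) = inner X Y - inner X Z.
Proof.
by move=> XL2 YL2 ZL2; rewrite -scaleN1r innerDr ?rpredZ// innerZr// mulN1r.
Qed.

Lemma innerBl X Y Z : X \in L2 -> Y \in L2 -> Z \in L2 ->
  inner (Y - Z) X = inner Y X - inner Z X.
Proof. by move=> XL2 YL2 ZL2; rewrite ![inner _ X]innerC innerBr. Qed.

Lemma inner0r X : inner X 0 = 0.
Proof.
by rewrite /inner; under eq_Rintegral do rewrite mulr0; rewrite Rintegral_cst// mul0r.
Qed.

Lemma inner_sumr I (s : seq I) (c : I -> R) (Y : I -> T -> R) X :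
  X \in L2 -> (forall i, Y i \in L2) ->
  inner X (\sum_(i <- s) c i *: Y i) = \sum_(i <- s) c i * inner X (Y i).
Proof.
move=> XL2 YL2; have cYL2 i : c i *: Y i \in L2 by rewrite rpredZ.
elim: s => [|i s IH]; first by rewrite !big_nil inner0r.
by rewrite !big_cons innerDr ?rpred_sum// innerZr// IH.
Qed.

Lemma inner_ge0 X : 0 <= inner X X.
Proof. by apply: Rintegral_ge0 => x _; rewrite -expr2 sqr_ge0. Qed.

Lemma innerBB X Y : X \in L2 -> Y \in L2 ->
  inner (X - Y) (X - Y) = inner X X - 2 * inner X Y + inner Y Y.
Proof.
move=> XL2 YL2; rewrite innerBr ?rpredB// !innerBl// (innerC Y X); ring.
Qed.

Lemma inner_CauchySchwarz X Y : X \in L2 -> Y \in L2 ->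
  inner X Y ^+ 2 <= inner X X * inner Y Y.
Proof.
move=> XL2 YL2; have quad a : 0 <= inner Y Y * a ^+ 2 + (- 2 * inner X Y) * a + inner X X.
  have aYL2 : a *: Y \in L2 by rewrite rpredZ.
  have := inner_ge0 (X - a *: Y); rewrite innerBB// !innerZr// (innerC (a *: Y)) innerZr//.
  by congr (0 <= _); ring.
pose p := Poly [:: inner X X; - 2 * inner X Y; inner Y Y].
have := @deg_le2_poly_ge0 R p (size_Poly _); rewrite !coefE/= => disc.
have : (- 2 * inner X Y) ^+ 2 - 4 * inner Y Y * inner X X <= 0.
  by apply: disc => a; rewrite horner_Poly/=; have := quad a; congr (0 <= _); ring.
by nra.
Qed.

End L2.

Section L2_convergence.
Context d (T : measurableType d) (R : realType) (mu : {measure set T -> \bar R}).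
Implicit Types (X Y Z : T -> R) (u : nat -> T -> R).
Local Notation L2 := (L2 mu).
Local Notation inner := (inner mu).

Definition sqdist X Y : R := inner (X - Y) (X - Y).

Lemma sqdistE X Y : X \in L2 -> Y \in L2 ->
  (\int[mu]_x ((X x - Y x) ^+ 2)%:E = (sqdist X Y)%:E)%E.
Proof.
move=> XL2 YL2; have XYL2 : X - Y \in L2 by rewrite rpredB.
rewrite -(has_integral_integral (has_integral_inner XYL2 XYL2)).
by apply: eq_integral => x _; rewrite expr2.
Qed.

Lemma sqdistC X Y : sqdist X Y = sqdist Y X.
Proof. by apply: eq_Rintegral => x _; rewrite -opprB mulrNN; ring. Qed.

Lemma cvgr0_sqr (a b : nat -> R) : (forall n, a n ^+ 2 <= b n) ->
  b n @[n --> \oo] --> 0 -> a n @[n --> \oo] --> 0.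
Proof.
move=> ab /cvgr0Pnorm_lt b0; apply/cvgr0Pnorm_lt => e e0.
apply: filterS (b0 _ (exprn_gt0 2 e0)) => n; rewrite ger0_norm => [be|]; last first.
  exact: le_trans (sqr_ge0 _) (ab n).
rewrite -(@ltr_pXn2r _ 2)// ?nnegrE ?(ltW e0)// real_normK ?num_real//.
exact: le_lt_trans (ab n) be.
Qed.

Lemma cvg_sqdistP u X : (forall n, u n \in L2) -> measurable_fun setT X ->
  (\int[mu]_x ((u n x - X x) ^+ 2)%:E)%E @[n --> \oo] --> 0%E <->
  X \in L2 /\ sqdist (u n) X @[n --> \oo] --> 0.
Proof.
move=> uL2 mX; split=> [uX|[XL2 uX]]; last first.
  by under eq_fun do rewrite sqdistE//; apply: cvg_EFin => //; exact: nearW.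
have /fine_cvgP[[N _ finN] uX0] := uX.
have XL2 : X \in L2.
  rewrite -(subKr (u N) X) rpredB//; apply/L2P; split.
    exact: measurable_funB (measurable_L2 (uL2 N)) mX.
  by have := finN N (leqnn N); rewrite fin_numE => /andP[_]; rewrite ltey.
by split=> //; exact: uX0.
Qed.

Lemma cvg_inner u X Z : (forall n, u n \in L2) -> X \in L2 -> Z \in L2 ->
  sqdist (u n) X @[n --> \oo] --> 0 -> inner (u n) Z @[n --> \oo] --> inner X Z.
Proof.
move=> uL2 XL2 ZL2 uX; apply/subr_cvg0.
apply: (@cvgr0_sqr _ (fun n => sqdist (u n) X * inner Z Z)) => [n|].
  by rewrite -innerBl// inner_CauchySchwarz ?rpredB.
by rewrite -[X in _ --> X](mul0r (inner Z Z)); apply: cvgM => //; exact: cvg_cst.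
Qed.

Lemma cvg_inner_sqr u X : (forall n, u n \in L2) -> X \in L2 ->
  sqdist (u n) X @[n --> \oo] --> 0 -> inner (u n) (u n) @[n --> \oo] --> inner X X.
Proof.
move=> uL2 XL2 uX.
have -> : (fun n => inner (u n) (u n)) =
    (fun n => sqdist (u n) X + 2 * inner (u n) X - inner X X).
  by apply/funext => n; rewrite /sqdist innerBB//; ring.
rewrite [X in _ --> X](_ : _ = 0 + 2 * inner X X - inner X X); last by ring.
apply: cvgB; last exact: cvg_cst.
by apply: cvgD => //; apply: cvgM; [exact: cvg_cst|exact: (cvg_inner uL2 XL2 XL2 uX)].
Qed.

Lemma cvgn_sqr_telescope (a : nat -> R) C :
  (forall n, \sum_(j < n) 2 ^+ j * (a j.+1 - a j) ^+ 2 <= C) -> cvgn a.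
Proof.
move=> aC; have -> : a = (fun n => a 0%N + series (telescope a) n).
  by apply/funext => n; rewrite telescopeK /= addrC addrNK.
apply: is_cvgD; first exact: is_cvg_cst.
apply: normed_cvg; apply: nondecreasing_is_cvgn.
  by apply: nondecreasing_series => j _ _; exact: normr_ge0.
exists (2 + C) => _ [n _ <-]; rewrite /normed_series_of seriesEord.
have term_le (j : nat) : `|a j.+1 - a j| <= 2^-1 ^+ j + 2 ^+ j * (a j.+1 - a j) ^+ 2.
  have e0 : 0 < 2 ^+ j :> R by rewrite exprn_gt0.
  rewrite exprVn -(real_normK (num_real (a j.+1 - a j))) -(ler_pM2l e0) mulrDr divff ?gt_eqF//.
  have := sqr_ge0 (2 ^+ j * `|a j.+1 - a j| - 1); have := normr_ge0 (a j.+1 - a j).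
  by nra.
apply: (le_trans (ler_sum _ (fun (j : 'I_n) _ => term_le j))).
rewrite big_split/=; apply: lerD; last exact: aC.
have -> : \sum_(i < n) 2^-1 ^+ i = 2 - 2 * 2^-1 ^+ n :> R.
  elim: n => [|n IH]; first by rewrite big_ord0 expr0 mulr1 subrr.
  by rewrite big_ord_recr/= IH exprS; field.
by rewrite gerBl mulr_ge0// exprn_ge0.
Qed.

Lemma ae_cvgn_sqr_telescope (v : nat -> T -> R) :
  (forall j, measurable_fun setT (v j)) ->
  (forall j, (\int[mu]_x ((v j.+1 x - v j x) ^+ 2)%:E <= (4^-1 ^+ j)%:E)%E) ->
  {ae mu, forall x, cvgn (v^~ x)}.
Proof.
move=> mv v4.
pose F x := (\sum_(j <oo) (2 ^+ j * (v j.+1 x - v j x) ^+ 2)%:E)%E.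
have term_ge0 j x : (0 <= (2 ^+ j * (v j.+1 x - v j x) ^+ 2)%:E)%E.
  by rewrite lee_fin mulr_ge0 ?sqr_ge0.
have mterm j : measurable_fun setT (fun x => (2 ^+ j * (v j.+1 x - v j x) ^+ 2)%:E).
  apply/measurable_EFinP; apply: measurable_funM => //; apply: measurable_funX.
  exact: measurable_funB.
have iF : mu.-integrable setT F.
  apply/integrableP; split.
    by apply: ge0_emeasurable_sum => [j x _ _|j _].
  under eq_integral do rewrite gee0_abs ?nneseries_ge0//.
  rewrite integral_nneseries//.
  apply: (@le_lt_trans _ _ (\sum_(j <oo) (2 / (2 ^ (j + 1))%:R)%:E)%E); last first.
    rewrite (_ : (\sum_(j <oo) _)%E = (2 / 2 ^+ 0)%:E) ?ltry//.
    by apply/cvg_lim => //; exact: cvg_geometric_eseries_half.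
  apply: lee_nneseries => [j _ _|j _]; first by apply: integral_ge0 => x _.
  under eq_integral do rewrite EFinM.
  rewrite ge0_integralZl ?lee_fin ?exprn_ge0//.
  - apply: (@le_trans _ _ ((2 ^+ j)%:E * (4^-1 ^+ j)%:E)%E).
      by apply: lee_wpmul2l => //; rewrite lee_fin exprn_ge0.
    rewrite -EFinM lee_fin -exprMn natrX exprD expr1 invfM mulrCA divff// mulr1 -exprVn.
    by rewrite (_ : 2 * 4^-1 = 2^-1)//; field.
  - apply/measurable_EFinP; apply: measurable_funX; exact: measurable_funB.
  - by move=> x _; rewrite lee_fin sqr_ge0.
apply: filterS (integrable_ae measurableT iF) => x /(_ I) finF.
apply: (@cvgn_sqr_telescope _ (fine (F x))) => n.
rewrite -lee_fin fineK// -sumEFin.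
have := @nneseries_lim_ge R (fun j => (2 ^+ j * (v j.+1 x - v j x) ^+ 2)%:E) xpredT 0%N n.
by rewrite big_mkord; apply=> j _ _; exact: term_ge0.
Qed.

Lemma fatou_ae (g : nat -> T -> \bar R) (h : T -> \bar R) (C : \bar R) :
  (forall j, measurable_fun setT (g j)) -> (forall j x, (0 <= g j x)%E) ->
  measurable_fun setT h -> (forall x, (0 <= h x)%E) ->
  {ae mu, forall x, g j x @[j --> \oo] --> h x} ->
  (\forall j \near \oo, (\int[mu]_x g j x <= C)%E) -> (\int[mu]_x h x <= C)%E.
Proof.
move=> mg g0 mh h0 gh [N _ gC].
have einf_ge0 x : (0 <= limn_einf (g^~ x))%E.
  rewrite limn_einf_lim; apply: lime_ge; first exact: is_cvg_einfs.
  by apply: nearW => n; apply: le_ereal_inf_tmp => _ [m _ <-]; exact: g0.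
have -> : (\int[mu]_x h x = \int[mu]_x limn_einf (g^~ x))%E.
  apply: ge0_ae_eq_integral => //.
    apply: measurableT_comp => //.
    apply: (@measurable_fun_limn_esup _ _ _ _ (fun j x => - g j x)%E) => j.
    exact: measurableT_comp.
  by apply: filterS gh => x /cvg_limn_einf_sup[-> _].
apply: (le_trans (fatou mu measurableT mg (fun j x _ => g0 j x))).
rewrite limn_einf_lim; apply: lime_le; first exact: is_cvg_einfs.
apply: nearW => n; apply: le_trans (gC (maxn n N) (leq_maxr _ _)).
by apply: ereal_inf_lbound; exists (maxn n N) => //=; exact: leq_maxl.
Qed.

Lemma measurable_limit (v : nat -> T -> R) : (forall j, measurable_fun setT (v j)) ->
  exists2 G : T -> R, measurable_fun setT G &
    forall x, cvgn (v^~ x) -> v j x @[j --> \oo] --> G x.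
Proof.
move=> mv; exists (fun x => fine (limn_esup (fun j => (v j x)%:E))).
  apply: (measurableT_comp (fine_measurable measurableT)).
  apply: (@measurable_fun_limn_esup _ _ _ _ (fun j x => (v j x)%:E)) => j.
  exact/measurable_EFinP.
move=> x /cvg_ex[l vl]; have vl' : (v j x)%:E @[j --> \oo] --> l%:E.
  by apply: cvg_EFin => //; exact: nearW.
by have [_ ->] := cvg_limn_einf_sup vl'.
Qed.

Lemma cauchy_subsequence (delta : nat -> R) : delta n @[n --> \oo] --> 0 ->
  exists k : nat -> nat, [/\ forall j, (j <= k j)%N, forall j, (k j <= k j.+1)%N
    & forall j, delta (k j) <= 4^-1 ^+ j].
Proof.
move=> delta0.
have /choice[m mP] (j : nat) : exists m, forall n, (m <= n)%N -> delta n <= 4^-1 ^+ j.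
  have e0 : 0 < 4^-1 ^+ j :> R by rewrite exprn_gt0.
  move/cvgr0Pnorm_lt: delta0 => /(_ _ e0)[m _ mP]; exists m => n /mP /ltW.
  exact: le_trans (ler_norm _).
exists (fun j => \sum_(i < j.+1) m i + j)%N; split=> j; first exact: leq_addl.
  by rewrite leq_add// [leqRHS]big_ord_recr leq_addr.
by apply: mP; rewrite big_ord_recr/= -addnA addnCA leq_addr.
Qed.

Theorem L2_complete u (delta : nat -> R) : (forall n, u n \in L2) ->
  (forall m n, (m <= n)%N -> sqdist (u m) (u n) <= delta m) ->
  delta n @[n --> \oo] --> 0 ->
  exists2 X, X \in L2 & forall n, sqdist (u n) X <= delta n.
Proof.
move=> uL2 u_delta delta0; have [k [le_k k_nd k_delta]] := cauchy_subsequence delta0.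
pose v j := u (k j); have mu_ n := measurable_L2 (uL2 n).
have [G mG vG] := measurable_limit (fun j => mu_ (k j)).
have aeG : {ae mu, forall x, v j x @[j --> \oo] --> G x}.
  have v4 j : (\int[mu]_x ((v j.+1 x - v j x) ^+ 2)%:E <= (4^-1 ^+ j)%:E)%E.
    rewrite (sqdistE (uL2 _) (uL2 _)) lee_fin sqdistC.
    exact: le_trans (u_delta _ _ (k_nd j)) (k_delta j).
  by apply: filterS (ae_cvgn_sqr_telescope (fun j => mu_ (k j)) v4) => x; exact: vG.
have uG n : (\int[mu]_x ((u n x - G x) ^+ 2)%:E <= (delta n)%:E)%E.
  apply: (@fatou_ae (fun j x => ((u n x - v j x) ^+ 2)%:E)).
  - move=> j; apply/measurable_EFinP; apply: measurable_funX.
    exact: measurable_funB (mu_ n) (mu_ (k j)).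
  - by move=> j x; rewrite lee_fin sqr_ge0.
  - by apply/measurable_EFinP; apply: measurable_funX; exact: measurable_funB.
  - by move=> x; rewrite lee_fin sqr_ge0.
  - apply: filterS aeG => x vx; apply: cvg_EFin; first exact: nearW.
    have uvG : u n x - v j x @[j --> \oo] --> u n x - G x by apply: cvgB => //; exact: cvg_cst.
    exact: (cvgM uvG uvG).
  exists n => // j /= nj; rewrite (sqdistE (uL2 _) (uL2 _)) lee_fin.
  by apply: u_delta; exact: leq_trans nj (le_k j).
have unGL2 n : u n - G \in L2.
  by apply/L2P; split; [exact: measurable_funB|apply: le_lt_trans (uG n) (ltry _)].
exists G => [|n]; first by rewrite -(subKr (u 0%N) G) rpredB.
by rewrite -lee_fin -sqdistE// -(subKr (u 0%N) G) rpredB.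
Qed.

End L2_convergence.

Section min_norm.
Context d (T : measurableType d) (R : realType) (mu : {measure set T -> \bar R}).
Implicit Types (X Y : T -> R).
Local Notation L2 := (L2 mu).
Local Notation inner := (inner mu).
Local Notation sqdist := (sqdist mu).

Lemma sqdist_parallelogram X Y : X \in L2 -> Y \in L2 ->
  sqdist X Y = 2 * inner X X + 2 * inner Y Y - 4 * inner (2^-1 *: (X + Y)) (2^-1 *: (X + Y)).
Proof.
move=> XL2 YL2; have XYL2 : X + Y \in L2 by rewrite rpredD.
rewrite /sqdist innerBB// innerZr ?rpredZ// (innerC _ (_ *: _)) innerZr// innerDr//.
by rewrite !(innerC _ (X + Y)) !innerDr// (innerC _ Y X); field.
Qed.

Theorem L2_min_norm (A : set (T -> R)) : A !=set0 ->
  (forall X, A X -> X \in L2) -> (forall X Y, A X -> A Y -> A (2^-1 *: (X + Y))) ->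
  (forall u X, (forall n, A (u n)) -> X \in L2 ->
    sqdist (u n) X @[n --> \oo] --> 0 -> A X) ->
  exists2 X0, A X0 & forall X, A X -> inner X0 X0 <= inner X X.
Proof.
move=> [XA AXA] AL2 Amid Acl.
pose E := [set inner X X | X in A]; pose m := inf E.
have infE : has_inf E.
  by split; [exists (inner XA XA), XA|exists 0 => _ [X _ <-]; exact: inner_ge0].
have m_le X : A X -> m <= inner X X by move=> AX; apply: (ge_inf infE.2); exists X.
have /choice[u uP] (n : nat) : exists X, A X /\ inner X X < m + n.+1%:R^-1.
  have [|_ [X AX <-] Xm] := @inf_adherent R E n.+1%:R^-1 _ infE; first by rewrite invr_gt0.
  by exists X.
have uA n : A (u n) by case: (uP n).
have uL2 n : u n \in L2 by exact: AL2.
have u_cauchy n k : (n <= k)%N -> sqdist (u n) (u k) <= 4 * n.+1%:R^-1.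
  move=> nk; rewrite sqdist_parallelogram//.
  have := m_le _ (Amid _ _ (uA n) (uA k)); have [_] := uP n; have [_] := uP k.
  have : (k.+1%:R^-1 : R) <= n.+1%:R^-1 by rewrite lef_pV2 ?posrE// ler_nat ltnS.
  by move: (n.+1%:R^-1) (k.+1%:R^-1) => x y; lra.
have harmonic0 : 4 * n.+1%:R^-1 @[n --> \oo] --> (0 : R).
  by rewrite -(mulr0 4); apply: cvgM; [exact: cvg_cst|exact: cvg_harmonic].
have [X0 X0L2 uX0] := L2_complete uL2 u_cauchy harmonic0.
have cvg_u : sqdist (u n) X0 @[n --> \oo] --> 0.
  apply: (squeeze_cvgr _ (cvg_cst 0) harmonic0).
  by apply: nearW => n; rewrite inner_ge0 uX0.
exists X0 => [|X AX]; first exact: Acl uA X0L2 cvg_u.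
apply: le_trans (m_le X AX).
have cvg_m : m + n.+1%:R^-1 @[n --> \oo] --> m.
  by rewrite -[X in _ --> X]addr0; apply: cvgD; [exact: cvg_cst|exact: cvg_harmonic].
apply: (ler_cvg_to (cvg_inner_sqr uL2 X0L2 cvg_u) cvg_m).
by apply: nearW => n; case: (uP n) => _ /ltW.
Qed.

End min_norm.

Section orthonormal_family.
Context d (T : measurableType d) (R : realType) (mu : {measure set T -> \bar R}).
Context (I : choiceType) (B : nat -> seq I) (e : I -> T -> R).
Local Notation L2 := (L2 mu).
Local Notation inner := (inner mu).
Local Notation sqdist := (sqdist mu).
Hypotheses (exB : exhaustion B) (eL2 : forall p, e p \in L2).
Hypothesis orth : forall p q, inner (e p) (e q) = (p == q)%:R.
Implicit Types (X L : T -> R) (a : I -> R).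

Definition coef X (p : I) : R := inner X (e p).

Definition psum a n : T -> R := \sum_(p <- B n) a p *: e p.

Lemma psum_L2 a n : psum a n \in L2.
Proof. by rewrite rpred_sum// => p _; rewrite rpredZ. Qed.

Lemma inner_psum X a n : X \in L2 ->
  inner X (psum a n) = \sum_(p <- B n) a p * coef X p.
Proof. by move=> XL2; rewrite inner_sumr. Qed.

Lemma coef_psum a n p : p \in B n -> coef (psum a n) p = a p.
Proof.
move=> pB; have [uB _ _] := exB.
rewrite /coef innerC inner_psum// (bigD1_seq p)//= /coef orth eqxx mulr1.
by rewrite big1 ?addr0// => q qp; rewrite orth eq_sym (negbTE qp) mulr0.
Qed.

Lemma inner_psum_psum a m n : (m <= n)%N ->
  inner (psum a n) (psum a m) = \sum_(p <- B m) a p ^+ 2.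
Proof.
move=> mn; have [_ ndB _] := exB; rewrite inner_psum ?psum_L2//.
by apply: eq_big_seq => p pB; rewrite coef_psum ?expr2//; exact: ndB pB.
Qed.

Lemma sqdist_psum X n : X \in L2 ->
  sqdist X (psum (coef X) n) = inner X X - \sum_(p <- B n) coef X p ^+ 2.
Proof.
move=> XL2; rewrite /sqdist innerBB ?psum_L2// inner_psum_psum// inner_psum//.
by under eq_bigr do rewrite -expr2; ring.
Qed.

Lemma bessel X : X \in L2 -> sqsummable (coef X) /\ sqsum (coef X) <= inner X X.
Proof.
move=> XL2; apply: (sqsummable_bound exB) => n.
by rewrite -subr_ge0 -sqdist_psum// inner_ge0.
Qed.

Lemma cvg_psum_coef L : L \in L2 ->
  \sum_(p <- B n) coef L p ^+ 2 @[n --> \oo] --> inner L L ->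
  sqdist (psum (coef L) n) L @[n --> \oo] --> 0.
Proof.
move=> LL2 cL; rewrite -(subrr (inner L L)).
rewrite (_ : (fun n => _) = (fun n => inner L L - \sum_(p <- B n) coef L p ^+ 2)).
  by apply: cvgB => //; exact: cvg_cst.
by apply/funext => n; rewrite sqdistC sqdist_psum.
Qed.

Lemma parseval X L : X \in L2 -> L \in L2 ->
  \sum_(p <- B n) coef L p ^+ 2 @[n --> \oo] --> inner L L ->
  usum (fun p => coef X p * coef L p) = inner X L.
Proof.
move=> XL2 LL2 /(cvg_psum_coef LL2) cL; have [coefX_l2 _] := bessel XL2.
have [coefL_l2 _] := bessel LL2.
have cvg_usum := cvg_sum_usum exB (sqsummableM coefX_l2 coefL_l2).
have cvg_psum := cvg_inner (psum_L2 (coef L)) LL2 XL2 cL.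
rewrite innerC; apply: (cvg_unique (@Rhausdorff R) cvg_usum).
apply: cvg_trans cvg_psum; apply: near_eq_cvg; apply: nearW => n.
by rewrite innerC inner_psum//; apply: eq_bigr => p _; rewrite mulrC.
Qed.

Lemma psum_limit a X : X \in L2 -> sqdist (psum a n) X @[n --> \oo] --> 0 ->
  [/\ coef X = a, sqsummable a & inner X X = sqsum a].
Proof.
move=> XL2 aX.
have coefX : coef X = a.
  apply/funext => p; have := cvg_inner (psum_L2 a) XL2 (eL2 p) aX.
  move=> /(cvg_unique (@Rhausdorff R)); apply.
  apply: cvg_near_cst; apply: filterS (exhaustion_near exB p) => n.
  exact: coef_psum.
have [a_l2 _] := bessel XL2; rewrite coefX in a_l2; split=> //.
have := cvg_inner_sqr (psum_L2 a) XL2 aX.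
move=> /(cvg_unique (@Rhausdorff R)); apply.
rewrite (_ : (fun n => _) = (fun n => \sum_(p <- B n) a p ^+ 2)).
  by apply: cvg_sum_fine_esum exB _ _ a_l2 => p; exact: sqr_ge0.
by apply/funext => n; rewrite inner_psum_psum.
Qed.

Theorem riesz_fischer a : sqsummable a ->
  exists2 X, X \in L2 & sqdist (psum a n) X @[n --> \oo] --> 0.
Proof.
move=> a_l2; pose tail n := sqsum a - \sum_(p <- B n) a p ^+ 2.
have a0 p : 0 <= a p ^+ 2 by exact: sqr_ge0.
have tail0 : tail n @[n --> \oo] --> 0.
  rewrite -(subrr (sqsum a)); apply: cvgB; first exact: cvg_cst.
  exact: cvg_sum_fine_esum.
have tail_le m n : (m <= n)%N -> sqdist (psum a m) (psum a n) <= tail m.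
  move=> mn; rewrite sqdistC /sqdist innerBB ?psum_L2// !inner_psum_psum//.
  have : \sum_(p <- B n) a p ^+ 2 <= sqsum a.
    rewrite -lee_fin fineK ?sum_le_esum//.
    by rewrite ge0_fin_numE//; apply: esum_ge0 => p _; rewrite lee_fin.
  rewrite /tail; lra.
have [X XL2 aX] := L2_complete (psum_L2 a) tail_le tail0.
exists X => //; apply: (squeeze_cvgr _ (cvg_cst 0) tail0).
by apply: nearW => n; rewrite inner_ge0 aX.
Qed.

Section moment_problem.
Context (J : Type) (Q : set J) (L : J -> T -> R) (r : J -> R).
Hypothesis LL2 : forall j, L j \in L2.
Hypothesis parsevalL : forall j,
  \sum_(p <- B n) coef (L j) p ^+ 2 @[n --> \oo] --> inner (L j) (L j).

Definition moment_solution X : Prop :=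
  X \in L2 /\ forall j, Q j -> inner X (L j) = r j.

Definition coef_solution a : Prop :=
  sqsummable a /\ forall j, Q j -> usum (fun p => a p * coef (L j) p) = r j.

Lemma coef_moment_solution X : moment_solution X -> coef_solution (coef X).
Proof.
move=> [XL2 XL]; split; first by case: (bessel XL2).
by move=> j Qj; rewrite parseval// XL.
Qed.

Lemma limit_coef_solution a X : coef_solution a -> X \in L2 ->
  sqdist (psum a n) X @[n --> \oo] --> 0 -> moment_solution X.
Proof.
move=> [_ aL] XL2 /(psum_limit XL2)[coefX _ _]; split=> // j Qj.
by rewrite -aL// -coefX parseval.
Qed.

Lemma min_moment_solution : (exists X, moment_solution X) ->
  exists2 X0, moment_solution X0 &
    forall X, moment_solution X -> inner X0 X0 <= inner X X.
Proof.
move=> [X XL]; apply: L2_min_norm; first by exists X.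
- by move=> Y [].
- move=> Y Z [YL2 YL] [ZL2 ZL]; split; first by rewrite rpredZ// rpredD.
  move=> j Qj; rewrite innerC innerZr ?rpredD// innerDr// !(innerC mu (L j)).
  by rewrite YL// ZL//; field.
- move=> u Y uL YL2 uY; split=> // j Qj.
  have := cvg_inner (fun n => (uL n).1) YL2 (LL2 j) uY.
  move=> /(cvg_unique (@Rhausdorff R)); apply.
  by apply: cvg_near_cst; apply: nearW => n; exact: (uL n).2.
Qed.

Theorem min_coef_solution : (exists X, moment_solution X) ->
  exists2 a0, coef_solution a0 & forall a, coef_solution a -> sqsum a0 <= sqsum a.
Proof.
move=> /min_moment_solution[X0 X0L X0min].
exists (coef X0); first exact: coef_moment_solution.
move=> a aL; have [X XL2 aX] := riesz_fischer aL.1.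
have [_ _ <-] := psum_limit XL2 aX.
apply: le_trans (X0min X (limit_coef_solution aL XL2 aX)).
by case: (bessel X0L.1).
Qed.

End moment_problem.

End orthonormal_family.

(** * The sparse linear Gaussian model *)

Lemma is_pinv_unique (R : realType) m n (A : 'M[R]_(m, n)) B C :
  is_pinv A B -> is_pinv A C -> B = C.
Proof.
move=> [ABA BAB AB BA] [ACA CAC AC CA].
have ABC : A *m B = A *m C.
  by rewrite -AB -{1}ACA -(mulmxA (A *m C)) trmx_mul AB AC mulmxA ABA.
have BCA : B *m A = C *m A.
  by rewrite -BA -{1}ACA -(mulmxA A) (mulmxA B) trmx_mul BA CA -mulmxA (mulmxA A) ABA.
by rewrite -BAB -mulmxA ABC mulmxA BCA.
Qed.

Section thin_svd.
Context {R : realType} (M N D : nat) (H : 'M[R]_(M, N)) (U : 'M[R]_(M, D)).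
Context (s : 'rV[R]_D) (V : 'M[R]_(N, D)).
Hypothesis svd : thin_svd H U s V.
Local Notation Ht := (V *m invmx (diag_mx s)).

Let UU : U^T *m U = 1%:M. Proof. by case: svd. Qed.
Let VV : V^T *m V = 1%:M. Proof. by case: svd. Qed.
Let HE : H = U *m diag_mx s *m V^T. Proof. by case: svd. Qed.

Let diag_unitmx : diag_mx s \in unitmx.
Proof.
rewrite unitmxE det_diag unitfE; apply/prodf_neq0 => i _.
by case: svd => _ _ s0 _; rewrite gt_eqF.
Qed.

Let tr_mulUH : U^T *m H = diag_mx s *m V^T.
Proof. by rewrite HE -!mulmxA (mulmxA U^T) UU mul1mx. Qed.

Lemma thin_svd_mulHt : H *m Ht = U.
Proof. by rewrite HE -!mulmxA (mulmxA V^T) VV mul1mx mulmxV// mulmx1. Qed.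

Lemma thin_svd_proj : U *m (U^T *m H) = H.
Proof. by rewrite tr_mulUH mulmxA -HE. Qed.

Lemma is_pinv_thin_svd : is_pinv Ht (U^T *m H).
Proof.
have HtK : U^T *m H *m Ht = 1%:M by rewrite -mulmxA thin_svd_mulHt.
have HtUH : Ht *m (U^T *m H) = V *m V^T.
  by rewrite tr_mulUH -!mulmxA (mulmxA (invmx _)) mulVmx// mul1mx.
split; first by rewrite -mulmxA HtK mulmx1.
- by rewrite HtK mul1mx.
- by rewrite HtUH trmx_mul trmxK.
- by rewrite HtK trmx1.
Qed.

Lemma thin_svd_pinvE Htp : is_pinv Ht Htp -> Htp = U^T *m H.
Proof. by move=> HtpP; exact: is_pinv_unique HtpP is_pinv_thin_svd. Qed.

End thin_svd.

Section gaussian_family.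
Context {R : realType} (M D : nat) (sigma : R) (U : 'M[R]_(M, D)).
Variable law : 'cV[R]_M -> probability (M.-tuple R) R.
Hypotheses (sigma_neq0 : sigma != 0) (UU : U^T *m U = 1%:M).
Hypothesis lawP : forall m, gauss_law sigma m (law m).
Implicit Types (m y : 'cV[R]_M) (t : M.-tuple R) (z : 'cV[R]_D) (q : 'I_D -> {poly R}).

Definition gcoord y : 'cV[R]_D := sigma^-1 *: (U^T *m y).

Lemma dot_gcoord z y : dot z (gcoord y) = dot (U *m z) y / sigma.
Proof. by rewrite dotZr dot_mulmx mulrC. Qed.

Lemma dot_gcoord_range m y : U *m (U^T *m m) = m ->
  dot (gcoord m) (gcoord y) = dot m y / sigma ^+ 2.
Proof.
by move=> UUm; rewrite dot_gcoord -scalemxAr UUm dotZl; field.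
Qed.

Lemma measurable_gcoord l m : measurable_fun setT (fun t => gcoord (tcol t + m) l 0).
Proof.
pose u : 'cV[R]_M := sigma^-1 *: (U *m delta_mx l 0).
have gcoordE y : gcoord y l 0 = dot u y.
  rewrite dotZl dot_mulmx /dot (bigD1 l)//= big1 => [|i il]; rewrite !mxE.
    by rewrite !eqxx mul1r addr0.
  by rewrite (negbTE il) mul0r.
under eq_fun do rewrite gcoordE dotDr.
by apply: measurable_funD => //; exact: measurable_dot_tcol.
Qed.

Lemma has_integral_gauss_ratio a b : has_integral (law a) (gauss_ratio sigma a b) 1.
Proof.
have mone : measurable_fun [set: M.-tuple R] (fun=> 1 : R) by [].
have := (cameron_martin sigma_neq0 _ (lawP a) (lawP b) mone).1 (has_integral_cst (law b) 1).
by congr has_integral; apply/funext => t; rewrite mulr1.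
Qed.

Lemma gauss_ratioN m t : gauss_ratio sigma m (- m) t = expR (- 2 * dot m (tcol t) / sigma ^+ 2).
Proof.
by congr expR; rewrite !sqnormE !dot_simp; field.
Qed.

Lemma has_integral_gcoord m q (a : 'I_D -> R) : has_integral (law m)
  (fun t => (\prod_l (q l).[gcoord (tcol t - m) l 0]) *
            expR (\sum_l a l * gcoord (tcol t - m) l 0))
  ((\prod_l (gauss_smooth (q l)).[a l]) * expR (\sum_l a l ^+ 2 / 2)).
Proof.
apply: has_integral_prod_poly_expR => [l|{}a]; first exact: measurable_gcoord.
pose z : 'cV[R]_D := \col_l a l; pose b := m + sigma *: (U *m z).
have := has_integralZl (expR (dot z z / 2)) (has_integral_gauss_ratio m b).
congr has_integral; [apply/funext => t|]; rewrite ?mulr1; last first.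
  by rewrite -sqnormE mulr_suml; congr expR; apply: eq_bigr => l _; rewrite mxE.
have -> : \sum_l a l * gcoord (tcol t - m) l 0 = dot z (gcoord (tcol t - m)).
  by apply: eq_bigr => l _; rewrite [z l 0]mxE.
have dotUz : dot (U *m z) (U *m z) = dot z z by rewrite dot_mulmx mulmxA UU mul1mx.
rewrite dot_gcoord -expRD; congr expR; rewrite /b !sqnormE !dot_simp dotUz (dotC m (U *m z)).
by field.
Qed.

End gaussian_family.

Section hermite_basis.
Context {R : realType} (M D : nat) (sigma : R) (U : 'M[R]_(M, D)).
Variable law : 'cV[R]_M -> probability (M.-tuple R) R.
Hypotheses (sigma_neq0 : sigma != 0) (UU : U^T *m U = 1%:M).
Hypothesis lawP : forall m, gauss_law sigma m (law m).
Variable m0 : 'cV[R]_M.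
Implicit Types (m y : 'cV[R]_M) (t : M.-tuple R) (p q : mindex D).
Local Notation gcoord := (gcoord sigma U).
Local Notation L2 := (L2 (law m0)).
Local Notation inner := (inner (law m0)).
Local Notation ratio := (gauss_ratio sigma m0).

Definition hbasis p y : R :=
  expR (- dot y m0 / sigma ^+ 2) *
  (\prod_l (hermite (p l)).[gcoord (y + m0) l 0]) / Num.sqrt (mfact R p).

Lemma mfact_gt0 p : 0 < mfact R p.
Proof. by apply: prodr_gt0 => l _; rewrite ltr0n fact_gt0. Qed.

Lemma measurable_prod_hermite (q : 'I_D -> {poly R}) :
  measurable_fun setT (fun t => \prod_l (q l).[gcoord (tcol t + m0) l 0]).
Proof.
exact: (measurable_prod_horner (fun l => measurable_gcoord sigma U l m0)).
Qed.

Lemma measurable_hbasis p : measurable_fun setT (fun t => hbasis p (tcol t)).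
Proof.
apply: measurable_funM => //; apply: measurable_funM; last exact: measurable_prod_hermite.
apply: measurableT_comp => //; apply: measurable_funM => //.
by apply: measurableT_comp => //; under eq_fun do rewrite dotC; exact: measurable_dot_tcol.
Qed.

(* The exponential factors of [hbasis] turn the law of mean m0 into the one of mean
   -m0, under which the [gcoord (y + m0) l 0] are independent standard normal. *)
Lemma has_integral_conj (q : 'I_D -> {poly R}) (a : 'I_D -> R) :
  has_integral (law m0) (fun t => expR (- 2 * dot m0 (tcol t) / sigma ^+ 2) *
    ((\prod_l (q l).[gcoord (tcol t + m0) l 0]) *
     expR (\sum_l a l * gcoord (tcol t + m0) l 0)))
  ((\prod_l (gauss_smooth (q l)).[a l]) * expR (\sum_l a l ^+ 2 / 2)).
Proof.
have mF : measurable_fun setT (fun t =>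
    (\prod_l (q l).[gcoord (tcol t + m0) l 0]) *
    expR (\sum_l a l * gcoord (tcol t + m0) l 0)).
  apply: measurable_funM; first exact: measurable_prod_hermite.
  exact: (measurable_expR_sum (fun l => measurable_gcoord sigma U l m0)).
have := has_integral_gcoord sigma_neq0 UU lawP (- m0) q a.
rewrite opprK => /(cameron_martin sigma_neq0 _ (lawP m0) (lawP (- m0)) mF).1.
by congr has_integral; apply/funext => t; rewrite gauss_ratioN.
Qed.

Lemma hbasis_has_integral p q : has_integral (law m0)
  (fun t => hbasis p (tcol t) * hbasis q (tcol t)) (p == q)%:R.
Proof.
pose c := (Num.sqrt (mfact R p))^-1 * (Num.sqrt (mfact R q))^-1.
have := has_integralZl c (has_integral_conj (fun l => hermite (p l) * hermite (q l)) (fun=> 0)).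
congr has_integral; [apply/funext => t|].
  rewrite [X in _ * expR X]big1 => [|l _]; last by rewrite mul0r.
  rewrite expR0 mulr1; under eq_bigr do rewrite hornerM.
  rewrite big_split/= /hbasis.
  have -> : - 2 * dot m0 (tcol t) / sigma ^+ 2 =
      - dot (tcol t) m0 / sigma ^+ 2 + - dot (tcol t) m0 / sigma ^+ 2.
    by rewrite dotC; field.
  by rewrite expRD /c; ring.
rewrite [X in _ * expR X]big1 => [|l _]; last by rewrite expr0n mul0r.
rewrite expR0 mulr1; under eq_bigr do rewrite gauss_smooth_hermiteM.
have [pq|/eqP pq] := eqVneq p q.
  rewrite /c pq -invfM -expr2 sqr_sqrtr ?(ltW (mfact_gt0 q))//.
  under eq_bigr do rewrite eqxx.
  by rewrite -/(mfact R q) mulVf// gt_eqF// mfact_gt0.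
have [l /negbTE pql] : exists l, p l != q l.
  by apply/existsP; apply: contra_notT pq => /existsPn pq; apply/ffunP => l; apply/eqP/negPn.
by rewrite (bigD1 l)//= pql mul0r mulr0.
Qed.

Lemma hbasis_L2 p : (fun t => hbasis p (tcol t)) \in L2.
Proof.
apply/L2P; split; first exact: measurable_hbasis.
have [i _] := hbasis_has_integral p p; have := integrable_lty measurableT i.
by under eq_integral do rewrite /= -expr2.
Qed.

Lemma hbasis_orthonormal p q :
  inner (fun t => hbasis p (tcol t)) (fun t => hbasis q (tcol t)) = (p == q)%:R.
Proof. by have [_] := hbasis_has_integral p q. Qed.

Lemma ratio_has_integral_sqr m : has_integral (law m0)
  (fun t => ratio m t * ratio m t) (expR (dot (m - m0) (m - m0) / sigma ^+ 2)).
Proof.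
pose h := m - m0.
have := has_integralZl (expR (dot h h / sigma ^+ 2))
  (has_integral_gauss_ratio sigma_neq0 lawP m0 (m0 + (h + h))).
rewrite mulr1; congr has_integral; apply/funext => t.
rewrite /gauss_ratio -!expRD; congr expR; rewrite /h !sqnormE !dot_simp (dotC m m0).
by field.
Qed.

Lemma ratio_L2 m : ratio m \in L2.
Proof.
apply/L2P; split; first exact: measurable_gauss_ratio.
have [i _] := ratio_has_integral_sqr m; have := integrable_lty measurableT i.
by under eq_integral do rewrite /= -expr2.
Qed.

Lemma inner_ratio m : inner (ratio m) (ratio m) = expR (dot (m - m0) (m - m0) / sigma ^+ 2).
Proof. by have [_] := ratio_has_integral_sqr m. Qed.

Lemma has_integral_law m (F : M.-tuple R -> R) : F \in L2 ->
  has_integral (law m) F (inner F (ratio m)).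
Proof.
move=> FL2; apply: (cameron_martin sigma_neq0 _ (lawP m0) (lawP m) (measurable_L2 FL2)).2.
by have := has_integral_inner (ratio_L2 m) FL2; rewrite innerC.
Qed.

Definition ratio_coef m p : R :=
  expR ((2 * sigma ^+ 2)^-1 * sqnorm m0 - (sigma ^+ 2)^-1 * dot m m0) *
  (mpow (gcoord m) p / Num.sqrt (mfact R p)).

Lemma inner_ratio_hbasis m p : U *m (U^T *m m) = m ->
  inner (ratio m) (fun t => hbasis p (tcol t)) = ratio_coef m p.
Proof.
move=> UUm; pose z := gcoord m.
pose c := expR (- dot m m0 / sigma ^+ 2 - (sqnorm m - sqnorm m0) / (2 * sigma ^+ 2)) /
  Num.sqrt (mfact R p).
suff [] : has_integral (law m0) (fun t => ratio m t * hbasis p (tcol t)) (ratio_coef m p) by [].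
have := has_integralZl c (has_integral_conj (fun l => hermite (p l)) (fun l => z l 0)).
congr has_integral; [apply/funext => t|].
  rewrite -/(dot z (gcoord (tcol t + m0))) (dot_gcoord_range sigma_neq0 _ UUm).
  rewrite /hbasis /gauss_ratio; set h := \prod_l _.
  transitivity (expR (- dot m m0 / sigma ^+ 2 - (sqnorm m - sqnorm m0) / (2 * sigma ^+ 2) +
      - 2 * dot m0 (tcol t) / sigma ^+ 2 + dot m (tcol t + m0) / sigma ^+ 2) *
      (h / Num.sqrt (mfact R p))); first by rewrite 2!expRD /c; ring.
  rewrite -[X in _ = _ * X]mulrA [RHS]mulrA -expRD; congr (expR _ * _).
  by rewrite !dot_simp (dotC (tcol t) m0); field.
under eq_bigr do rewrite gauss_smooth_hermite hornerXn.
have -> : \sum_l z l 0 ^+ 2 / 2 = dot m m / (2 * sigma ^+ 2).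
  by rewrite -mulr_suml -/(sqnorm z) sqnormE dot_gcoord_range//; field.
transitivity (expR (- dot m m0 / sigma ^+ 2 - (sqnorm m - sqnorm m0) / (2 * sigma ^+ 2) +
  dot m m / (2 * sigma ^+ 2)) * (mpow z p / Num.sqrt (mfact R p))).
  by rewrite expRD /c /mpow; ring.
by congr (expR _ * _); rewrite !sqnormE; field.
Qed.

Lemma cvg_sum_ratio_coef m : U *m (U^T *m m) = m ->
  \sum_(p <- mindex_box D K) ratio_coef m p ^+ 2 @[K --> \oo] --> inner (ratio m) (ratio m).
Proof.
move=> UUm; pose z := gcoord m.
pose A := expR ((2 * sigma ^+ 2)^-1 * sqnorm m0 - (sigma ^+ 2)^-1 * dot m m0).
have -> : inner (ratio m) (ratio m) = A ^+ 2 * \prod_l expR (z l 0 ^+ 2).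
  rewrite inner_ratio -expR_sum -/(sqnorm z) sqnormE dot_gcoord_range//.
  rewrite [A ^+ 2]expr2 -!expRD.
  by congr expR; rewrite sqnormE !dot_simp (dotC m0 m); field.
have -> : (fun K => \sum_(p <- mindex_box D K) ratio_coef m p ^+ 2) =
    (fun K => A ^+ 2 * \prod_l series (exp_coeff (z l 0 ^+ 2)) K.+1).
  apply/funext => K; under [in RHS]eq_bigr do rewrite seriesEord/=.
  rewrite bigA_distr_bigA mulr_sumr -big_mindex_box/=; apply: eq_bigr => q _.
  rewrite exprMn; congr (_ * _).
  rewrite exprMn exprVn sqr_sqrtr ?(ltW (mfact_gt0 _))// /mpow /mfact -prodfV -prodrXl -big_split/=.
  by apply: eq_bigr => l _; rewrite ffunE /exp_coeff/= -!exprM mulnC.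
apply: cvgM; first exact: cvg_cst.
apply: (@cvg_big R _ *%R 1 xpredT (@mul_continuous R)) => l _.
rewrite (cvg_shiftS (series (exp_coeff (z l 0 ^+ 2)))).
exact: is_cvg_series_exp_coeff.
Qed.

End hermite_basis.

Section product_derivatives.
Context {R : realType} (D : nat).
Implicit Types (z : 'cV[R]_D) (c : R).

Lemma partial_prod (f : 'I_D -> R -> R) (df : R -> R) c (l : 'I_D) :
  (forall x : R, is_derive x 1 (f l) (df x)) ->
  partial l (fun z => c * \prod_i f i (z i 0)) =
  (fun z => c * \prod_i (if i == l then df else f i) (z i 0)).
Proof.
move=> dl; apply/funext => z; pose k := c * \prod_(i | i != l) f i (z i 0).
have lineE (h : R) :
    c * \prod_i f i ((h *: delta_mx l 0 + z) i 0) = k * f l (h + z l 0).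
  rewrite (bigD1 l)//= !mxE !eqxx mulr1 mulrA mulrAC; congr (_ * _ * _).
  by apply: eq_bigr => i /negbTE il; rewrite !mxE il mulr0 add0r.
transitivity ('D_1 (fun x : R => k *: f l x) (z l 0)).
  rewrite /partial /derive; set u := (X in lim (X @ _) = _); set v := (X in _ = lim (X @ _)).
  suff -> : u = v by [].
  have := lineE 0; rewrite scale0r !add0r => at0.
  by apply/funext => h; rewrite /u /v /= at0 lineE /GRing.scale/= mulr1.
have [_ ->] := is_deriveZ k (dl (z l 0)).
rewrite (bigD1 l)//= eqxx /GRing.scale/= /k mulrAC mulrA; congr (_ * _ * _).
by apply: eq_bigr => i /negbTE ->.
Qed.

Variables (f : 'I_D -> nat -> R -> R).
Hypothesis df : forall i k (x : R), is_derive x 1 (f i k) (f i k.+1 x).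

Lemma iter_partial_prod c l n (k : 'I_D -> nat) :
  iter n (partial l) (fun z => c * \prod_i f i (k i) (z i 0)) =
  (fun z => c * \prod_i f i (if i == l then n + k i else k i)%N (z i 0)).
Proof.
elim: n => [|n IH] /=; first by apply/funext => z; under [in RHS]eq_bigr do rewrite if_same.
pose g i := f i (if i == l then n + k i else k i)%N.
have dg (x : R) : is_derive x 1 (g l) (f l (n + k l).+1 x) by rewrite /g eqxx.
rewrite IH (partial_prod c dg).
by apply/funext => z; congr (_ * _); apply: eq_bigr => i _; rewrite /g; case: eqP => // ->.
Qed.

Lemma mderiv_prod c (p : mindex D) :
  mderiv p (fun z => c * \prod_i f i 0%N (z i 0)) =
  (fun z => c * \prod_i f i (p i) (z i 0)).
Proof.
have derive_seq (s : seq 'I_D) : uniq s ->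
    foldr (fun l h => iter (p l) (partial l) h) (fun z => c * \prod_i f i 0%N (z i 0)) s =
    (fun z => c * \prod_i f i (if i \in s then p i else 0)%N (z i 0)).
  elim: s => [|l s IH]//= /andP[/negbTE ls us].
  rewrite IH// iter_partial_prod; apply/funext => z; congr (_ * _); apply: eq_bigr => i _.
  by rewrite inE; case: eqP => [->|_] //=; rewrite ls addn0.
rewrite /mderiv derive_seq ?enum_uniq//; apply/funext => z; congr (_ * _).
by apply: eq_bigr => i _; rewrite mem_enum.
Qed.

End product_derivatives.

Section hermite_generating_function.
Context {R : realType}.

Lemma is_derive_hermite_gf (a : R) k (x : R) :
  is_derive x 1 (fun x => (hermite k).[a - x] * expR (a * x - x ^+ 2 / 2))
    ((hermite k.+1).[a - x] * expR (a * x - x ^+ 2 / 2)).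
Proof.
have dsub : is_derive x 1 (fun x : R => a - x) (-1).
  by apply: is_derive_eq; rewrite /GRing.scale/=; ring.
have dquad : is_derive x 1 (fun x : R => a * x - x ^+ 2 / 2) (a - x).
  by apply: is_derive_eq; rewrite /GRing.scale/=; field.
have dexp := @is_derive1_comp R expR _ x _ _ (is_derive_expR _) dquad.
have dherm := @is_derive1_comp R (horner (hermite k)) _ x _ _ (is_derive_poly _ _) dsub.
apply: (is_derive_eq (is_deriveM dherm dexp)).
by rewrite /GRing.scale/= hornerD hornerN hornerM hornerX; ring.
Qed.

Lemma mderiv_hermite_gf D (p : mindex D) (w : 'cV[R]_D) (c : R) :
  mderiv p (fun z : 'cV[R]_D => c * \prod_l expR (w l 0 * z l 0 - z l 0 ^+ 2 / 2)) 0 =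
  c * \prod_l (hermite (p l)).[w l 0].
Proof.
pose f l k (x : R) := (hermite k).[w l 0 - x] * expR (w l 0 * x - x ^+ 2 / 2).
have -> : (fun z : 'cV[R]_D => c * \prod_l expR (w l 0 * z l 0 - z l 0 ^+ 2 / 2)) =
    (fun z => c * \prod_l f l 0%N (z l 0)).
  by apply/funext => z; congr (_ * _); apply: eq_bigr => l _; rewrite /f hornerC mul1r.
rewrite (mderiv_prod (fun l => is_derive_hermite_gf (w l 0))); congr (_ * _).
by apply: eq_bigr => l _; rewrite /f mxE mulr0 expr0n mul0r !subr0 expR0 mulr1.
Qed.

End hermite_generating_function.

Section chi.
Context {R : realType} (M N D : nat) (H : 'M[R]_(M, N)) (sigma : R) (x0 : 'cV[R]_N)
  (U : 'M[R]_(M, D)) (Ht : 'M[R]_(N, D)).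
Hypotheses (sigma_neq0 : sigma != 0) (UU : U^T *m U = 1%:M) (HHt : H *m Ht = U).
Local Notation gcoord := (gcoord sigma U).

Lemma rho_factorization (y : 'cV[R]_M) (z : 'cV[R]_D) :
  expR (- (2 * sigma ^+ 2)^-1 * (2 * (y^T *m H *m (x0 - sigma *: (Ht *m z))) 0 0 +
    sqnorm (H *m (sigma *: (Ht *m z))) - sqnorm (H *m x0))) *
  expR (sigma^-1 * (x0^T *m H^T *m H *m Ht *m z) 0 0) =
  expR (- (2 * sigma ^+ 2)^-1 * (2 * dot y (H *m x0) - sqnorm (H *m x0))) *
  \prod_l expR (gcoord (y + H *m x0) l 0 * z l 0 - z l 0 ^+ 2 / 2).
Proof.
set m0 := H *m x0.
have HHtz : H *m (sigma *: (Ht *m z)) = sigma *: (U *m z) by rewrite -scalemxAr mulmxA HHt.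
have -> : (y^T *m H *m (x0 - sigma *: (Ht *m z))) 0 0 = dot y m0 - sigma * dot y (U *m z).
  by rewrite -mulmxA mulmxBr HHtz -dotE !dot_simp.
have -> : (x0^T *m H^T *m H *m Ht *m z) 0 0 = dot m0 (U *m z).
  by rewrite -trmx_mul -(mulmxA _ H Ht) HHt -mulmxA -dotE.
have -> : \prod_l expR (gcoord (y + m0) l 0 * z l 0 - z l 0 ^+ 2 / 2) =
    expR (dot (U *m z) (y + m0) / sigma - dot z z / 2).
  rewrite -expR_sum big_split/= sumrN -mulr_suml -/(sqnorm z) -/(dot _ z) sqnormE.
  by rewrite dotC dot_gcoord.
have dotUz : dot (U *m z) (U *m z) = dot z z by rewrite dot_mulmx mulmxA UU mul1mx.
rewrite HHtz -!expRD; congr expR.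
by rewrite !sqnormE !dot_simp dotUz !(dotC (U *m z)); field.
Qed.

Lemma chi_hbasis (p : mindex D) (y : 'cV[R]_M) (a : R) :
  expR (- (2 * sigma ^+ 2)^-1 * sqnorm (H *m x0)) * (a / Num.sqrt (mfact R p) *
    mderiv p (fun z : 'cV[R]_D =>
      expR (- (2 * sigma ^+ 2)^-1 * (2 * (y^T *m H *m (x0 - sigma *: (Ht *m z))) 0 0 +
        sqnorm (H *m (sigma *: (Ht *m z))) - sqnorm (H *m x0))) *
      expR (sigma^-1 * (x0^T *m H^T *m H *m Ht *m z) 0 0)) 0) =
  a * hbasis sigma U (H *m x0) p y.
Proof.
under [in LHS]eq_fun do rewrite rho_factorization.
rewrite mderiv_hermite_gf /hbasis.
set h := \prod_l _; set m0 := H *m x0.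
transitivity (expR (- (2 * sigma ^+ 2)^-1 * sqnorm m0 +
  - (2 * sigma ^+ 2)^-1 * (2 * dot y m0 - sqnorm m0)) * (a / Num.sqrt (mfact R p) * h)).
  by rewrite expRD; ring.
have -> : - (2 * sigma ^+ 2)^-1 * sqnorm m0 +
    - (2 * sigma ^+ 2)^-1 * (2 * dot y m0 - sqnorm m0) = - dot y m0 / sigma ^+ 2.
  by field.
by ring.
Qed.

End chi.

Section observation_law.
Context {R : realType} {d : measure_display} {Omega : measurableType d}.
Variables (P : probability Omega R) (M N : nat) (H : 'M[R]_(M, N)).
Variables (noise : Omega -> M.-tuple R) (sigma : R).
Hypothesis noiseP : gauss_noise P noise sigma.
Implicit Types (m : 'cV[R]_M) (x : 'cV[R]_N) (gh : 'cV[R]_M -> R).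

Lemma tshift_noise_mfun m : tshift m \o noise \in mfun.
Proof. by rewrite inE; exact: (measurableT_comp (measurable_tshift m) noiseP.1). Qed.

Definition obs_law m : probability (M.-tuple R) R :=
  distribution P (mfun_Sub (tshift_noise_mfun m)).

Lemma obs_tshift x w : obs H noise x w = tcol (tshift (H *m x) (noise w)).
Proof. by rewrite tcol_tshift. Qed.

Lemma gauss_law_obs_law m : sigma != 0 -> gauss_law sigma m (obs_law m).
Proof.
move=> sigma_neq0.
have noise0 : gauss_law sigma 0 (distribution P (mfun_Sub (mem_set noiseP.1 : noise \in mfun))).
  move=> B mB; have [_ noiseE] := noiseP; apply: etrans (noiseE B mB) _.
  by apply: congr1; apply: eq_bigr => i _; rewrite mxE.
by have := gauss_law_tshift sigma_neq0 m noise0; rewrite add0r.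
Qed.

Lemma ge0_integral_obs_law x (f : 'cV[R]_M -> \bar R) :
  measurable_fun setT (fun t : M.-tuple R => f (tcol t)) -> (forall y, (0 <= f y)%E) ->
  (\int[obs_law (H *m x)]_t f (tcol t) = \int[P]_w f (obs H noise x w))%E.
Proof.
move=> mf f0; rewrite ge0_integral_distribution//.
by apply: eq_integral => w _; rewrite obs_tshift.
Qed.

Lemma has_integral_obs_law x gh v : is_estimator gh ->
  has_integral (obs_law (H *m x)) (gh \o @tcol R M) v <->
  has_integral P (fun w => gh (obs H noise x w)) v.
Proof.
move=> mgh; have mphi : measurable_fun setT (tshift (H *m x) \o noise).
  by have := tshift_noise_mfun (H *m x); rewrite inE.
have -> : (fun w => gh (obs H noise x w)) =
    (fun w => cst 1 w * (gh \o @tcol R M) ((tshift (H *m x) \o noise) w)).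
  by apply/funext => w; rewrite obs_tshift mul1r.
apply: has_integral_change => // f mf f0.
rewrite ge0_integral_distribution//; apply: eq_integral => w _.
by rewrite mul1e.
Qed.

End observation_law.

Section estimation.
Context {R : realType} {d : measure_display} {Omega : measurableType d}.
Variables (P : probability Omega R) (M N D S : nat) (H : 'M[R]_(M, N)).
Variables (noise : Omega -> M.-tuple R) (sigma : R) (U : 'M[R]_(M, D)).
Variables (x0 : 'cV[R]_N) (g c : 'cV[R]_N -> R).
Hypotheses (noiseP : gauss_noise P noise sigma) (sigma_neq0 : sigma != 0).
Hypotheses (UU : U^T *m U = 1%:M) (UH : U *m (U^T *m H) = H) (spx0 : sparse_set S x0).
Implicit Types (x : 'cV[R]_N) (gh : 'cV[R]_M -> R) (a : mindex D -> R).

Local Notation mu := (obs_law noiseP (H *m x0)).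
Local Notation L2 := (L2 mu).
Local Notation inner := (inner mu).
Local Notation basis := (fun p (t : M.-tuple R) => hbasis sigma U (H *m x0) p (tcol t)).
Local Notation hermite_psum := (psum (@mindex_box D) basis).
Local Notation lik x := (gauss_ratio sigma (H *m x0) (H *m x)).
Local Notation moment gh :=
  (moment_solution mu (sparse_set S) (fun x => lik x) (fun x => c x + g x) (gh \o @tcol R M)).

Definition bias_coefs : set (mindex D -> R) :=
  coef_solution mu basis (sparse_set S) (fun x => lik x) (fun x => c x + g x).

Let obs_lawP m : gauss_law sigma m (obs_law noiseP m).
Proof. exact: gauss_law_obs_law. Qed.

Let UHx x : U *m (U^T *m (H *m x)) = H *m x.
Proof. by rewrite !mulmxA -(mulmxA U) UH. Qed.

Let basis_L2 p : basis p \in L2.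
Proof. exact: (hbasis_L2 sigma_neq0 UU obs_lawP). Qed.

Let basis_orth p q : inner (basis p) (basis q) = (p == q)%:R.
Proof. exact: (hbasis_orthonormal sigma_neq0 UU obs_lawP). Qed.

Let lik_L2 x : lik x \in L2.
Proof. exact: (ratio_L2 sigma_neq0 obs_lawP). Qed.

Lemma coef_lik x : coef mu basis (lik x) = ratio_coef sigma U (H *m x0) (H *m x).
Proof.
by apply/funext => p; exact: (inner_ratio_hbasis sigma_neq0 UU obs_lawP).
Qed.

Let parseval_lik x :
  \sum_(p <- mindex_box D K) coef mu basis (lik x) p ^+ 2 @[K --> \oo] --> inner (lik x) (lik x).
Proof.
rewrite coef_lik; exact: (cvg_sum_ratio_coef sigma_neq0 obs_lawP (UHx x)).
Qed.

Lemma estimator_has_integral gh x : is_estimator gh -> gh \o @tcol R M \in L2 ->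
  has_integral P (fun w => gh (obs H noise x w)) (inner (gh \o @tcol R M) (lik x)).
Proof.
move=> mgh ghL2; apply/(has_integral_obs_law H noiseP _ _ mgh).
exact: (has_integral_law sigma_neq0 obs_lawP).
Qed.

Lemma estimator_mean gh x : is_estimator gh -> gh \o @tcol R M \in L2 ->
  mean P H noise gh x = inner (gh \o @tcol R M) (lik x).
Proof. by move=> mgh ghL2; have [_] := estimator_has_integral x mgh ghL2. Qed.

Lemma finite_variance_L2 gh : is_estimator gh ->
  (est_variance P H noise gh x0 < +oo)%E -> gh \o @tcol R M \in L2.
Proof.
move=> mgh vgh; set v := mean P H noise gh x0.
have ghvL2 : gh \o @tcol R M - cst v \in L2.
  apply/L2P; split; first exact: measurable_funB.
  rewrite (ge0_integral_obs_law H noiseP x0 (f := fun y => ((gh y - v) ^+ 2)%:E))//.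
    by apply/measurable_EFinP; apply: measurable_funX; exact: measurable_funB.
  by move=> y; rewrite lee_fin sqr_ge0.
by rewrite -(subrK (cst v) (gh \o @tcol R M)) rpredD//; exact: Lfun_cst.
Qed.

Lemma est_varianceE gh : is_estimator gh -> gh \o @tcol R M \in L2 ->
  est_variance P H noise gh x0 =
  (inner (gh \o @tcol R M) (gh \o @tcol R M) - mean P H noise gh x0 ^+ 2)%:E.
Proof.
move=> mgh ghL2; set v := mean P H noise gh x0; set X := gh \o @tcol R M.
have [mX _] := (L2P _ _).1 ghL2.
rewrite /est_variance -(ge0_integral_obs_law H noiseP x0 (f := fun y => ((gh y - v) ^+ 2)%:E)).
- have gh_v : has_integral mu X v.
    by rewrite /v estimator_mean//; exact: (has_integral_law sigma_neq0 obs_lawP).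
  have := has_integralD (has_integralD (has_integral_inner ghL2 ghL2)
    (has_integralZl (- 2 * v) gh_v)) (has_integral_cst mu (v ^+ 2)).
  rewrite (_ : _ + v ^+ 2 = inner X X - v ^+ 2); last by ring.
  move=> /has_integral_integral <-; apply: eq_integral => t _.
  by rewrite /X/=; congr EFin; ring.
- by apply/measurable_EFinP; apply: measurable_funX; exact: measurable_funB.
- by move=> y; rewrite lee_fin sqr_ge0.
Qed.

Lemma admissibleP gh : admissible P H noise S g c x0 gh <-> is_estimator gh /\ moment gh.
Proof.
split=> [[mgh _ vgh biasE]|[mgh [ghL2 ghL]]].
  have ghL2 := finite_variance_L2 mgh vgh; split=> //; split=> // x spx.
  by have [_ <-] := biasE x spx; rewrite /bias estimator_mean// subrK.
split=> //; first by have [] := estimator_has_integral x0 mgh ghL2.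
  by rewrite est_varianceE// ltry.
move=> x spx; split; first by have [] := estimator_has_integral x mgh ghL2.
by rewrite /bias estimator_mean// ghL// addrK.
Qed.

Lemma admissible_variance gh : admissible P H noise S g c x0 gh ->
  est_variance P H noise gh x0 =
  (inner (gh \o @tcol R M) (gh \o @tcol R M) - (c x0 + g x0) ^+ 2)%:E.
Proof.
by move=> /admissibleP[mgh [ghL2 ghL]]; rewrite est_varianceE// estimator_mean// ghL.
Qed.

Lemma series_limitP a gh :
  L2_series_limit P H noise (fun p y => a p * hbasis sigma U (H *m x0) p y) x0 gh <->
  [/\ is_estimator gh, gh \o @tcol R M \in L2 &
      sqdist mu (hermite_psum a K) (gh \o @tcol R M) @[K --> \oo] --> 0].
Proof.
pose partial K y : R :=
  \sum_(q : {ffun 'I_D -> 'I_K.+1})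
    (fun p => a p * hbasis sigma U (H *m x0) p y) [ffun l => val (q l)].
have partialE K t : partial K (tcol t) = hermite_psum a K t.
  rewrite /partial (big_mindex_box (fun p => a p * hbasis sigma U (H *m x0) p (tcol t))).
  by rewrite /psum fct_sumE.
have distE K : is_estimator gh ->
    (\int[P]_w ((partial K (obs H noise x0 w) - gh (obs H noise x0 w)) ^+ 2)%:E =
     \int[mu]_t ((hermite_psum a K t - (gh \o @tcol R M) t) ^+ 2)%:E)%E.
  move=> mgh; rewrite -(ge0_integral_obs_law H noiseP x0
      (f := fun y => ((partial K y - gh y) ^+ 2)%:E)).
  - by apply: eq_integral => t _; rewrite partialE.
  - apply/measurable_EFinP; apply: measurable_funX; apply: measurable_funB => //.
    under eq_fun do rewrite partialE; exact: measurable_L2 (psum_L2 _ basis_L2 a K).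
  - by move=> y; rewrite lee_fin sqr_ge0.
have cvgE : is_estimator gh ->
    (\int[P]_w ((partial K (obs H noise x0 w) - gh (obs H noise x0 w)) ^+ 2)%:E)%E
      @[K --> \oo] --> 0%E <->
    gh \o @tcol R M \in L2 /\
      sqdist mu (hermite_psum a K) (gh \o @tcol R M) @[K --> \oo] --> 0.
  move=> mgh; under eq_fun do rewrite distE//.
  by apply: cvg_sqdistP => // K; exact: psum_L2.
by split=> [[mgh /(cvgE mgh)[]]|[mgh ghL2 cgh]]; split=> //; exact/(cvgE mgh).
Qed.

Lemma exists_series_limit a : sqsummable a -> exists gh,
  L2_series_limit P H noise (fun p y => a p * hbasis sigma U (H *m x0) p y) x0 gh.
Proof.
move=> a_l2; have [X XL2 aX] := riesz_fischer (@exhaustion_mindex_box D) basis_L2 basis_orth a_l2.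
pose G (y : 'cV[R]_M) := X [tuple y i 0 | i < M]; exists G.
have tcolK : G \o @tcol R M = X.
  rewrite /G; apply/funext => t /=; congr X.
  by apply: eq_from_tnth => i; rewrite tnth_mktuple mxE.
by apply/series_limitP; rewrite /is_estimator tcolK; split=> //; exact: measurable_L2 XL2.
Qed.

Lemma series_limit_admissible a gh : bias_coefs a ->
  L2_series_limit P H noise (fun p y => a p * hbasis sigma U (H *m x0) p y) x0 gh ->
  admissible P H noise S g c x0 gh /\
  est_variance P H noise gh x0 = (sqsum a - (c x0 + g x0) ^+ 2)%:E.
Proof.
move=> aL /series_limitP[mgh ghL2 cgh].
have ghL : moment gh.
  exact: (limit_coef_solution (@exhaustion_mindex_box D) basis_L2 basis_orth lik_L2
    parseval_lik aL).
have adm : admissible P H noise S g c x0 gh by apply/admissibleP.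
split=> //; rewrite admissible_variance//.
by have [_ _ ->] := psum_limit (@exhaustion_mindex_box D) basis_L2 basis_orth ghL2 cgh.
Qed.

Lemma admissible_bias_coefs gh : admissible P H noise S g c x0 gh -> exists2 a, bias_coefs a &
  sqsum a - (c x0 + g x0) ^+ 2 <= fine (est_variance P H noise gh x0).
Proof.
move=> adm; have [_ ghL] := (admissibleP gh).1 adm.
exists (coef mu basis (gh \o @tcol R M)).
  exact: (coef_moment_solution (@exhaustion_mindex_box D) basis_L2 basis_orth lik_L2 parseval_lik).
rewrite admissible_variance//= lerD2r.
by have [] := bessel (@exhaustion_mindex_box D) basis_L2 basis_orth ghL.1.
Qed.

Lemma exists_min_bias_coefs : valid_bias P H noise S g c x0 ->
  exists2 a0, bias_coefs a0 & forall a, bias_coefs a -> sqsum a0 <= sqsum a.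
Proof.
move=> [gh /admissibleP[_ ghL]].
apply: (min_coef_solution (@exhaustion_mindex_box D) basis_L2 basis_orth lik_L2 parseval_lik).
by exists (gh \o @tcol R M).
Qed.

Lemma min_varE a0 : bias_coefs a0 -> (forall a, bias_coefs a -> sqsum a0 <= sqsum a) ->
  min_var P H noise S g c x0 = sqsum a0 - (c x0 + g x0) ^+ 2.
Proof.
move=> a0L a0min; have [gh /(series_limit_admissible a0L)[adm var_gh]] :=
  exists_series_limit a0L.1.
rewrite /min_var; set E := (X in inf X); set v := (X in _ = X).
have lbE : lbound E v.
  by move=> _ [gh' /admissible_bias_coefs[a aL va] <-]; apply: le_trans va; rewrite lerD2r a0min.
have Ev : E v by exists gh => //; rewrite var_gh.
apply/eqP; rewrite eq_le; apply/andP; split; first by apply: ge_inf Ev; exists v.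
by apply: lb_le_inf => //; exists v.
Qed.

Lemma bias_coefs_usum a : bias_coefs a <-> sqsummable a /\ forall x, sparse_set S x ->
  c x = expR ((2 * sigma ^+ 2)^-1 * sqnorm (H *m x0) -
              (sigma ^+ 2)^-1 * (x^T *m H^T *m H *m x0) 0 0) *
        usum (fun p => a p / Num.sqrt (mfact R p) * mpow (sigma^-1 *: (U^T *m H *m x)) p) - g x.
Proof.
have usumE x : usum (fun p => a p * coef mu basis (lik x) p) =
    expR ((2 * sigma ^+ 2)^-1 * sqnorm (H *m x0) -
          (sigma ^+ 2)^-1 * (x^T *m H^T *m H *m x0) 0 0) *
    usum (fun p => a p / Num.sqrt (mfact R p) * mpow (sigma^-1 *: (U^T *m H *m x)) p).
  rewrite -(usumZl (@exhaustion_mindex_box D)) ?expR_gt0// coef_lik.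
  congr usum; apply/funext => p.
  rewrite /ratio_coef /gcoord dotE trmx_mul !mulmxA; ring.
by split=> -[a_l2 aL]; split=> // x spx; rewrite ?usumE -?usumE ?aL// ?addrK ?subrK.
Qed.

End estimation.

Theorem theorem6 (R : realType) (d : measure_display) (Omega : measurableType d)
  (P : probability Omega R) (M N S D : nat) (H : 'M[R]_(M, N)) (sigma : R)
  (noise : Omega -> M.-tuple R) (g c : 'cV[R]_N -> R) (x0 : 'cV[R]_N)
  (U : 'M[R]_(M, D)) (s : 'rV[R]_D) (V : 'M[R]_(N, D)) (Htp : 'M[R]_(D, N)) :
  (1 <= S)%N -> (S <= N)%N -> (S < spark H)%N ->
  0 < sigma -> gauss_noise P noise sigma ->
  sparse_set S x0 ->
  D = \rank H -> thin_svd H U s V ->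
  let Ht : 'M[R]_(N, D) := V *m invmx (diag_mx s) in
  is_pinv Ht Htp ->
  valid_bias P H noise S g c x0 ->
  let gamma := c x0 + g x0 in
  let Cset : set (mindex D -> R) :=
    [set a | in_l2 a /\
      forall x, sparse_set S x ->
        c x = expR ((2 * sigma ^+ 2)^-1 * sqnorm (H *m x0)
                    - (sigma ^+ 2)^-1 * (x^T *m H^T *m H *m x0) 0 0)
              * usum (fun p : mindex D =>
                   a p / Num.sqrt (mfact R p) * mpow (sigma^-1 *: (Htp *m x)) p)
              - g x] in
  let rho (y : 'cV[R]_M) (x : 'cV[R]_N) : R :=
    expR (- (2 * sigma ^+ 2)^-1 *
          (2 * (y^T *m H *m (x0 - x)) 0 0 + sqnorm (H *m x) - sqnorm (H *m x0))) in
  let chi (p : mindex D) (y : 'cV[R]_M) : R :=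
    mderiv p (fun z : 'cV[R]_D =>
        rho y (sigma *: (Ht *m z)) *
        expR (sigma^-1 * (x0^T *m H^T *m H *m Ht *m z) 0 0)) 0 in
  let term (a : mindex D -> R) (p : mindex D) (y : 'cV[R]_M) : R :=
    expR (- (2 * sigma ^+ 2)^-1 * sqnorm (H *m x0)) *
    (a p / Num.sqrt (mfact R p) * chi p y) in
  (* (1) *)
  (exists a0, Cset a0 /\ (forall a, Cset a -> l2sq a0 <= l2sq a) /\
     min_var P H noise S g c x0 = l2sq a0 - gamma ^+ 2) /\
  (* (2) *)
  (forall a, Cset a ->
     (exists gh, L2_series_limit P H noise (term a) x0 gh) /\
     (forall gh, L2_series_limit P H noise (term a) x0 gh ->
        admissible P H noise S g c x0 gh)) /\
  (* (3) *)
  (forall a0, Cset a0 -> (forall a, Cset a -> l2sq a0 <= l2sq a) ->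
     forall gh, L2_series_limit P H noise (term a0) x0 gh ->
       is_LMV P H noise S g c x0 gh).
Proof.
move=> _ _ _ sigma0 noiseP spx0 _ svd Ht pinv valid gamma Cset rho chi term.
have sigma_neq0 : sigma != 0 by rewrite gt_eqF.
have [UU _ _ _] := svd; have UH := thin_svd_proj svd.
have termE a : term a = (fun p y => a p * hbasis sigma U (H *m x0) p y).
  apply/funext => p; apply/funext => y.
  exact: (chi_hbasis x0 sigma_neq0 UU (thin_svd_mulHt svd)).
have CsetE a : Cset a <-> bias_coefs S H U x0 g c noiseP a.
  rewrite /Cset /= (thin_svd_pinvE svd pinv); apply: iff_sym.
  exact: (bias_coefs_usum S x0 g c noiseP sigma_neq0 UU UH).
split.
  have [a0 a0L a0min] := exists_min_bias_coefs noiseP sigma_neq0 UU UH valid.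
  exists a0; split; first exact/CsetE.
  split; first by move=> a /CsetE; exact: a0min.
  exact: (min_varE sigma_neq0 UU UH spx0 a0L a0min).
split=> [a /CsetE aL|a0 /CsetE a0L a0min gh]; rewrite termE.
  split; first exact: (exists_series_limit H x0 noiseP sigma_neq0 UU aL.1).
  by move=> gh /(series_limit_admissible sigma_neq0 UU UH spx0 aL)[].
move=> /(series_limit_admissible sigma_neq0 UU UH spx0 a0L)[adm var_gh].
split=> //; rewrite var_gh (min_varE sigma_neq0 UU UH spx0 a0L)// => a /CsetE.
exact: a0min.
Qed.
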